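(* There is an absolute constant $C>0$ with the following property. Let $U$ be a finite set, let $\mathcal F\subseteq 2^U\setminus\{\varnothing\}$ be nonempty, and suppose that $\mathrm{VC}(\mathcal F)\le d$ for an integer $d\ge1$. For $0<\varepsilon\le 1/2$, set $$p=\min\left\{1,\;C\,q(\mathcal F)\log\frac{d+1}{\varepsilon}\right\}.$$ If $W\sim\mathrm{Bin}(U,p)$, then $\Pr_W[\exists S\in\mathcal F: S\subseteq W]\ge 1-\varepsilon$. In particular, $p_c(\mathcal F)\le C\,q(\mathcal F)\log(d+1)$.
   Context: $\log$ is the natural logarithm. $W\sim\mathrm{Bin}(U,p)$ means that each point of the finite set $U$ is included in the random set $W$ independently with probability $p$. VC dimension: a set $D\subseteq U$ is shattered by $\mathcal F$ if $\{S\cap D:S\in\mathcal F\}=2^D$; $\mathrm{VC}(\mathcal F)$ is the largest size of a set shattered by $\mathcal F$. Let $\mathcal F\subseteq 2^U\setminus\{\varnothing\}$ be nonempty. The threshold $p_c(\mathcal F)$ is the unique $p\in[0,1]$ such that $\Pr_W[\exists S\in\mathcal F:S\subseteq W]=1/2$ for $W\sim\mathrm{Bin}(U,p)$. A family $\mathcal G\subseteq 2^U$ covers $\mathcal F$ if every $S\in\mathcal F$ contains some $T\in\mathcal G$ as a subset. The expectation threshold $q(\mathcal F)$ is the largest $p\in[0,1]$ for which some family $\mathcal G\subseteq2^U$ covering $\mathcal F$ satisfies $\sum_{T\in\mathcal G}p^{|T|}\le \frac12$ (with the convention $p^{0}=1$). *)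

(* Defs.v *)
From HB Require Import structures.
From mathcomp Require Import all_boot all_order all_algebra.
From mathcomp Require Import all_classical all_reals all_analysis.

Set Implicit Arguments.
Unset Strict Implicit.
Unset Printing Implicit Defensive.

Import Order.TTheory GRing.Theory Num.Theory.
Import numFieldNormedType.Exports.
Local Open Scope ring_scope.

Definition shatters (U : finType) (F : {set {set U}}) (D : {set U}) : bool :=
  [set S :&: D | S in F] == powerset D.

Definition VC (U : finType) (F : {set {set U}}) : nat :=
  \max_(D : {set U} | shatters F D) #|D|.

Definition covers (U : finType) (G F : {set {set U}}) : bool :=
  [forall S in F, [exists T in G, T \subset S]].

Definition Bin_mass (R : realType) (U : finType) (p : R) (W : {set U}) : R :=
  \prod_(x : U) (if x \in W then p else 1 - p).

Definition Bin_Pr (R : realType) (U : finType) (p : R) (E : pred {set U}) : R :=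
  \sum_(W : {set U} | E W) Bin_mass p W.

Definition contains_member (U : finType) (F : {set {set U}}) : pred {set U} :=
  fun W => [exists S in F, S \subset W].

(* [xget 0 A] picks an element of [A], and is [0] if [A] is empty. By
   [thresholdP] and [threshold_unique] the choice below is not arbitrary. *)
Definition threshold (R : realType) (U : finType) (F : {set {set U}}) : R :=
  xget 0 [set p : R | 0 <= p <= 1 /\ Bin_Pr p (contains_member F) = 1 / 2]%classic.

Definition cheap_cover_at (R : realType) (U : finType) (F : {set {set U}}) :
    set R :=
  [set p : R | 0 <= p <= 1 /\
    exists G : {set {set U}},
      covers G F /\ \sum_(T in G) p ^+ #|T| <= 1 / 2]%classic.
Arguments cheap_cover_at R [U] F.

(* The largest element of [cheap_cover_at R F]; it exists for nonempty [F]
   whose members are nonempty, see [expectation_thresholdP]. *)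
Definition expectation_threshold (R : realType) (U : finType)
    (F : {set {set U}}) : R :=
  xget 0 (cheap_cover_at R F `&` ubound (cheap_cover_at R F))%classic.

Lemma Bin_mass_sum (R : realType) (U : finType) (p : R) :
  \sum_(W : {set U}) Bin_mass p W = 1.
Proof.
rewrite /Bin_mass -bigA_distr.
rewrite big1 => [|i _] /=; last by rewrite addrC subrK.
by [].
Qed.

Lemma Bin_Pr_poly (R : realType) (U : finType) (E : pred {set U}) :
  exists P : {poly R}, forall p, Bin_Pr p E = P.[p].
Proof.
exists (\sum_(W : {set U} | E W)
          \prod_(x : U) (if x \in W then 'X else 1 - 'X)) => p.
rewrite horner_sum; apply: eq_bigr => W _; rewrite horner_prod.
by apply: eq_bigr => x _; case: ifP; rewrite !hornerE.
Qed.

Lemma Bin_Pr0 (R : realType) (U : finType) (F : {set {set U}}) :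
  finset.set0 \notin F -> Bin_Pr (0 : R) (contains_member F) = 0.
Proof.
move=> F0; apply: big1 => W /existsP[S /andP[SF SW]].
have /set0Pn[x xS] : S != finset.set0 by apply: contraNneq F0 => <-.
by rewrite /Bin_mass (bigD1 x) //= (fintype.subsetP SW) // mul0r.
Qed.

Lemma Bin_Pr1 (R : realType) (U : finType) (F : {set {set U}}) :
  F != finset.set0 -> Bin_Pr (1 : R) (contains_member F) = 1.
Proof.
move=> /set0Pn[S SF]; rewrite /Bin_Pr (bigD1 finset.setT) /=; last first.
  by apply/existsP; exists S; rewrite SF finset.subsetT.
rewrite [X in X + _]big1 => [|x _]; last by rewrite inE.
rewrite big1 ?addr0 // => W /andP[_ WT].
have /subsetPn[x _ xW] : ~~ (finset.setT \subset W) by rewrite finset.subTset.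
by rewrite /Bin_mass (bigD1 x) //= (negbTE xW) subrr mul0r.
Qed.

Lemma Bin_Pr_le (R : realType) (U : finType) (F : {set {set U}}) (p p' : R) :
  0 <= p -> p <= p' -> p' <= 1 ->
  Bin_Pr p (contains_member F) <= Bin_Pr p' (contains_member F).
Proof.
move=> p0 pp' p'1.
pose k (a b : bool) : R :=
  if a then (if b then p else 0) else (if b then p' - p else 1 - p').
pose K (W V : {set U}) := \prod_(x : U) k (x \in W) (x \in V).
have K0 W V : 0 <= K W V.
  by apply: prodr_ge0 => x _; rewrite /k; do 2 case: ifP => _ //;
    rewrite subr_ge0.
have KW W : Bin_mass p W = \sum_V K W V.
  transitivity (\prod_(x : U) (k (x \in W) true + k (x \in W) false)).
    apply: eq_bigr => x _; rewrite /k; case: ifP => _; rewrite ?addr0 //.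
    by rewrite [RHS]addrC addrA subrK.
  by rewrite bigA_distr; apply: eq_bigr => V _; apply: eq_bigr => x _;
    case: (x \in V).
have KV V : Bin_mass p' V = \sum_W K W V.
  transitivity (\prod_(x : U) (k true (x \in V) + k false (x \in V))).
    apply: eq_bigr => x _; rewrite /k; case: ifP => _; rewrite ?add0r //.
    by rewrite [RHS]addrC subrK.
  by rewrite bigA_distr; apply: eq_bigr => W _; apply: eq_bigr => x _;
    case: (x \in W).
rewrite /Bin_Pr (eq_bigr _ (fun W _ => KW W)) (eq_bigr _ (fun V _ => KV V)).
rewrite [leRHS]exchange_big /=.
rewrite [leRHS](bigID (contains_member F)) /=.
apply: ler_wpDr; first by do 2 apply: sumr_ge0 => ? _.
apply: ler_sum => W /existsP[S /andP[SF SW]].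
rewrite [leLHS](bigID (contains_member F)) /= [X in _ + X]big1 ?addr0 //.
move=> V VF; have /subsetPn[x xW xV] : ~~ (W \subset V).
  apply: contra VF => WV; apply/existsP; exists S.
  by rewrite SF (fintype.subset_trans SW).
by rewrite /K (bigD1 x) //= xW (negbTE xV) mul0r.
Qed.

Lemma thresholdP (R : realType) (U : finType) (F : {set {set U}}) :
  finset.set0 \notin F -> F != finset.set0 ->
  0 <= threshold R F <= 1 /\
  Bin_Pr (threshold R F) (contains_member F) = 1 / 2.
Proof.
move=> F0 Fn0; pose A := [set p : R | 0 <= p <= 1 /\
  Bin_Pr p (contains_member F) = 1 / 2]%classic.
suff : A (xget 0 A) by [].
apply: xgetPex.
have [P PE] := Bin_Pr_poly R (contains_member F).
have [] := @IVT R (horner P) 0 1 (1 / 2) ler01.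
- by apply: continuous_subspaceT => x; exact: continuous_horner.
- rewrite -!PE Bin_Pr0 // Bin_Pr1 // minEle maxEle ler01.
  by rewrite divr_ge0 //= ler_pdivrMr ?mul1r ?ler1n.
- by move=> c; rewrite in_itv /= => c01 Pc; exists c; split; rewrite ?PE.
Qed.

Lemma threshold_unique (R : realType) (U : finType) (F : {set {set U}})
    (p : R) :
  finset.set0 \notin F -> F != finset.set0 ->
  0 <= p <= 1 -> Bin_Pr p (contains_member F) = 1 / 2 -> p = threshold R F.
Proof.
move=> F0 Fn0.
have [P PE] := Bin_Pr_poly R (contains_member F).
have H (a b : R) : 0 <= a -> a < b -> b <= 1 ->
    Bin_Pr a (contains_member F) = 1 / 2 ->
    Bin_Pr b (contains_member F) = 1 / 2 -> False.
  move=> a0 ab b1 Pa Pb.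
  suff /eqP Q0 : P - (1 / 2)%:P == 0.
    have := Bin_Pr0 R F0; rewrite PE.
    by move/eqP: Q0; rewrite subr_eq0 => /eqP ->; rewrite hornerC => /eqP;
      rewrite mulf_eq0 oner_eq0 invr_eq0 pnatr_eq0.
  apply/negP => /negP Qn0.
  pose n := size (P - (1 / 2)%:P).
  pose f (i : nat) : R := a + (b - a) / i.+1%:R.
  suff rf : all (root (P - (1 / 2)%:P)) [seq f i | i <- iota 0 n].
    suff /(max_poly_roots Qn0 rf) : uniq [seq f i | i <- iota 0 n].
      by rewrite size_map size_iota ltnn.
    rewrite map_inj_uniq ?iota_uniq // => i j /addrI.
    have ba : b - a != 0 by rewrite subr_eq0 gt_eqF.
    by move=> /(mulfI ba)/invr_inj/eqP; rewrite eqr_nat => /eqP[].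
  apply/allP => _ /mapP[i _ ->]; rewrite rootE hornerD hornerN hornerC -PE subr_eq0.
  have af : a <= f i by rewrite lerDl divr_ge0 // subr_ge0 ltW.
  have fb : f i <= b.
    rewrite -lerBrDl ler_pdivrMr ?ltr0n // ler_peMr ?ler1n //.
    by rewrite subr_ge0 ltW.
  have f0 : 0 <= f i := le_trans a0 af.
  have f1 : f i <= 1 := le_trans fb b1.
  by rewrite eq_le -{1}Pb -{1}Pa !Bin_Pr_le.
move=> /andP[p0 p1] Pp; have [/andP[t0 t1] Pt] := thresholdP R F0 Fn0.
by have [/H||] // := ltgtP p (threshold R F); [case|move/H; case].
Qed.

Lemma expectation_thresholdP (R : realType) (U : finType)
    (F : {set {set U}}) :
  finset.set0 \notin F -> F != finset.set0 ->
  cheap_cover_at R F (expectation_threshold R F) /\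
  ubound (cheap_cover_at R F) (expectation_threshold R F).
Proof.
move=> F0 Fn0; set A := cheap_cover_at R F.
suff : (A `&` ubound A)%classic (xget 0 (A `&` ubound A)%classic) by [].
apply: xgetPex.
have A0 : A 0.
  split; first by rewrite lexx ler01.
  exists [set [set x]%SET | x : U]%SET; split.
    apply/forallP => S; apply/implyP => SF.
    have /set0Pn[x xS] : S != finset.set0 by apply: contraNneq F0 => <-.
    apply/existsP; exists [set x]%SET; rewrite finset.sub1set xS andbT.
    by apply/imsetP; exists x.
  rewrite big1 ?divr_ge0 // => _ /imsetP[x _ ->].
  by rewrite cards1 expr1.
have uA : has_ubound A by exists 1 => p [/andP[]].
have cA : closed A.
  have -> : A = (`[0%R, 1%R] `&` \bigcup_(G in [set G | covers G F])
      (horner (\sum_(T in G) 'X^#|T|) @^-1` [set x : R | x <= 1 / 2]))%classic.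
    apply/seteqP; split => p /=.
      move=> [p01 [G [GF Gp]]]; split; first by rewrite in_itv.
      exists G => //=; rewrite horner_sum.
      by under eq_bigr do rewrite hornerXn.
    rewrite in_itv /= => -[p01 [G /= GF]].
    rewrite horner_sum; under eq_bigr do rewrite hornerXn.
    by move=> Gp; split => //; exists G.
  apply: closedI; first exact: interval_closed.
  apply: closed_bigcup; first exact: finite_finset.
  move=> G _; apply: preimage_closed; last exact: closed_le.
  by move=> x _; exact: continuous_horner.
exists (sup A); split; last by apply: sup_upper_bound; split => //; exists 0.
by apply: cA; apply: closure_sup => //; exists 0.
Qed.

(* Main.v *)
Require Import Defs.
From mathcomp Require Import all_boot all_order all_algebra.
From mathcomp Require Import all_classical all_reals all_analysis.
From mathcomp Require Import ring lra zify.
Import Order.TTheory GRing.Theory Num.Theory.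
Import numFieldNormedType.Exports.
Import boot.fintype boot.finset.
Local Open Scope ring_scope.

Set Implicit Arguments.
Unset Strict Implicit.
Unset Printing Implicit Defensive.

(* Fix [Q] slightly above the expectation threshold, so that every cover is
   expensive at [Q], and expose [W] in rounds of density a large constant times
   [Q]. After each round every member [S] of the family is replaced by a
   fragment [T \subset S] with [W :|: T] containing a member, or is discarded
   and covered by a set [T \in V (W :|: T)]; as [T] only has to be found inside
   [W :|: T], the expected cost of the discarded part is small. In the rounds
   of Park and Pham the fragments halve in size, which from size [poly d] takes
   [O(log d)] rounds.

   A single preliminary round brings members of any size down to size
   [O(d log d)]. To each [Z] attach the probability measure on the members
   inside [Z] minimizing the energy [\sum_x load x ^ 2]. By optimality each
   member inside [Z] carries load at least the energy, hence meets the set [H]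
   of points of load at least [2 ^- i] in many points for some scale [i], unless
   the energy is at most [poly d]. There are [poly(2 ^ i)] such points, hence
   [2 ^ O(i d)] traces of the family on [H] by Sauer-Shelah, so members with
   more than [C d i] points in [H] are covered cheaply by their traces. *)

(** * Random subsets *)

Lemma Bin_mass_ge0 (R : realType) (U : finType) (p : R) (W : {set U}) :
  0 <= p <= 1 -> 0 <= Bin_mass p W.
Proof.
move=> /andP[p0 p1]; apply: prodr_ge0 => x _.
by case: ifP => _ //; rewrite subr_ge0.
Qed.

(** The condition [W :|: T = Z] leaves the points of [T] free and fixes all others, so the sum lacks
    exactly the factors [p] of [Bin_mass p Z] at the points of [T]. *)
Lemma Bin_mass_setU (R : realType) (U : finType) (p : R) (T Z : {set U}) :
  T \subset Z ->
  p ^+ #|T| * \sum_(W : {set U} | W :|: T == Z) Bin_mass p W = Bin_mass p Z.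
Proof.
move=> TZ.
pose f (x : U) (b : bool) : R :=
  if (b || (x \in T)) == (x \in Z) then (if b then p else 1 - p) else 0.
have -> : \sum_(W : {set U} | W :|: T == Z) Bin_mass p W =
    \prod_(x : U) (f x true + f x false).
  rewrite bigA_distr [RHS](bigID (fun W : {set U} => W :|: T == Z)) /=.
  rewrite [X in _ + X]big1 ?addr0.
    apply: eq_bigr => W /eqP WZ; apply: eq_bigr => x _.
    by rewrite /f -WZ inE; case: (x \in W); rewrite eqxx.
  move=> W WZ; have [x xWZ] : exists x, (x \in W :|: T) != (x \in Z).
    by apply/existsP; apply: contraR WZ => /existsPn H; apply/eqP/setP => x;
      have := H x; rewrite negbK => /eqP.
  by rewrite (bigD1 x) //= /f; move: xWZ; rewrite inE; case: (x \in W) => /=;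
    move=> /negbTE ->; rewrite mul0r.
rewrite -prodr_const /Bin_mass [X in _ * X](bigID (mem T)).
rewrite [RHS](bigID (mem T)) /= mulrA.
rewrite -big_split /=; congr (_ * _); apply: eq_bigr => x.
  by move=> xT; rewrite /f xT (subsetP TZ) //= addrC subrK mulr1.
move=> xT; rewrite /f (negbTE xT); case: (x \in Z) => /=.
  by rewrite addr0.
by rewrite add0r.
Qed.

(** Substitute [Z = W :|: T] for [W] and apply [Bin_mass_setU]. It then suffices to bound the cost
    of [V Z] at [Q / p] for each fixed [Z]. *)
Lemma expected_cover_cost (R : realType) (U : finType) (p Q : R)
    (V : {set U} -> {set {set U}}) :
  0 < p ->
  \sum_(W : {set U}) Bin_mass p W * (\sum_(T | T \in V (W :|: T)) Q ^+ #|T|) =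
  \sum_(Z : {set U}) Bin_mass p Z *
    \sum_(T in V Z | T \subset Z) (Q / p) ^+ #|T|.
Proof.
move=> p0.
under eq_bigr do rewrite big_distrr /= big_mkcond /=.
rewrite exchange_big /=.
under [RHS]eq_bigr do rewrite big_distrr /= big_mkcond /=.
rewrite [RHS]exchange_big /=; apply: eq_bigr => T _.
rewrite (partition_big (fun W => W :|: T) predT) //=.
apply: eq_bigr => Z _.
have [TZ|TZ] := boolP (T \subset Z); last first.
  rewrite andbF big_pred0 // => W; apply: contraNF TZ => /eqP <-.
  by rewrite subsetUr.
rewrite andbT.
rewrite (eq_bigr (fun W => if T \in V Z then Bin_mass p W * Q ^+ #|T| else 0)).
  case: ifP => TV; last by rewrite big1.
  rewrite -big_distrl /= -(Bin_mass_setU p TZ) expr_div_n.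
  by field; rewrite expf_neq0 // gt_eqF.
by move=> W /eqP ->.
Qed.

(** The union of two independent samples misses a point with probability [(1 - p) * (1 - r)]. *)
Lemma Bin_Pr_union (R : realType) (U : finType) (p r : R)
    (E : pred {set U}) :
  Bin_Pr (p + r - p * r) E =
  \sum_(W : {set U}) Bin_mass p W * Bin_Pr r (fun W' => E (W :|: W')).
Proof.
rewrite /Bin_Pr.
under [RHS]eq_bigr do rewrite big_distrr /= big_mkcond /=.
rewrite big_mkcond /= (eq_bigr (fun Z => \sum_(W : {set U})
  \sum_(W' : {set U} | W :|: W' == Z)
    if E Z then Bin_mass p W * Bin_mass r W' else 0)).
  rewrite exchange_big /=; apply: eq_bigr => W _.
  rewrite [RHS](partition_big (fun W' => W :|: W') predT) //=.
  by apply: eq_bigr => Z _; apply: eq_bigr => W' /eqP ->.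
move=> Z _; case: ifP => _; last by do 2 rewrite big1 //= => ? _.
pose k (a b c : bool) : R := if (a || b) == c then
  (if a then p else 1 - p) * (if b then r else 1 - r) else 0.
transitivity (\prod_(x : U) (\sum_(a : bool) \sum_(b : bool) k a b (x \in Z))).
  by apply: eq_bigr => x _; rewrite !big_bool /k; case: (x \in Z) => /=; ring.
have boolE (F : bool -> R) : \sum_(a : bool) F a = F true + F false.
  by rewrite big_bool.
under eq_bigr do rewrite boolE.
rewrite bigA_distr; apply: eq_bigr => W _.
have -> : \prod_x (if x \in W then \sum_b k true b (x \in Z)
    else \sum_b k false b (x \in Z)) =
  \prod_x (k (x \in W) true (x \in Z) + k (x \in W) false (x \in Z)).
  by apply: eq_bigr => x _; rewrite !boolE; case: ifP.
rewrite bigA_distr (bigID (fun W' : {set U} => W :|: W' == Z)) /=.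
rewrite [X in _ + X]big1 ?addr0.
  apply: eq_bigr => W' /eqP WZ; rewrite -big_split; apply: eq_bigr => x _ /=.
  by rewrite /k -WZ inE; case: (x \in W'); rewrite eqxx.
move=> W' WZ; have [x xWZ] : exists x, (x \in W :|: W') != (x \in Z).
  by apply/existsP; apply: contraR WZ => /existsPn H; apply/eqP/setP => x;
    have := H x; rewrite negbK => /eqP.
by rewrite (bigD1 x) //= /k; move: xWZ; rewrite inE; case: (x \in W') => /=;
  move=> /negbTE ->; rewrite mul0r.
Qed.

(** * Fragments and rounds *)

Definition cover_cost (R : realType) (U : finType) (Q : R)
    (G : {set {set U}}) : R := \sum_(T in G) Q ^+ #|T|.

Definition expensive (R : realType) (U : finType) (Q c : R)
    (F : {set {set U}}) : Prop :=
  forall G : {set {set U}}, covers G F -> c < cover_cost Q G.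

(** All small completions of [W] are collected, inside a member or not: a larger family has fewer
    covers, so it is only more expensive. *)
Definition fragments (U : finType) (F : {set {set U}}) (s : nat)
    (W : {set U}) : {set {set U}} :=
  [set T : {set U} | (#|T| < s)%N && contains_member F (W :|: T)].

Lemma contains_memberS (U : finType) (F : {set {set U}}) (W W' : {set U}) :
  W \subset W' -> contains_member F W -> contains_member F W'.
Proof.
move=> WW' /existsP[S /andP[SF SW]]; apply/existsP; exists S.
by rewrite SF (subset_trans SW).
Qed.

Lemma Bin_Pr_ge0 (R : realType) (U : finType) (p : R) (E : pred {set U}) :
  0 <= p <= 1 -> 0 <= Bin_Pr p E.
Proof. by move=> p01; apply: sumr_ge0 => W _; exact: Bin_mass_ge0. Qed.

Lemma Bin_PrC (R : realType) (U : finType) (p : R) (E : pred {set U}) :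
  Bin_Pr p E + Bin_Pr p (predC E) = 1.
Proof. by rewrite -(Bin_mass_sum U p) [RHS](bigID E). Qed.

Lemma sub_Bin_Pr (R : realType) (U : finType) (p : R) (E E' : pred {set U}) :
  0 <= p <= 1 -> subpred E E' -> Bin_Pr p E <= Bin_Pr p E'.
Proof.
move=> p01 EE'; rewrite /Bin_Pr [leLHS]big_mkcond [leRHS]big_mkcond /=.
apply: ler_sum => W _; case: ifP => [/EE' ->//|_].
by case: ifP => // _; exact: Bin_mass_ge0.
Qed.

Lemma Bin_Pr_le1 (R : realType) (U : finType) (p : R) (E : pred {set U}) :
  0 <= p <= 1 -> Bin_Pr p E <= 1.
Proof. by move=> p01; rewrite -(Bin_PrC p E) lerDl Bin_Pr_ge0. Qed.

Lemma Bin_Pr_markov (R : realType) (U : finType) (p a b : R)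
    (X : {set U} -> R) :
  0 <= p <= 1 -> 0 < a -> (forall W, 0 <= X W) ->
  \sum_W Bin_mass p W * X W <= a * b ->
  Bin_Pr p (fun W => a <= X W) <= b.
Proof.
move=> p01 a0 X0 EX; rewrite -(ler_pM2l a0); apply: le_trans EX.
rewrite [leRHS](bigID (fun W => a <= X W)) /= ler_wpDr //.
  by apply: sumr_ge0 => W _; rewrite mulr_ge0 // Bin_mass_ge0.
rewrite /Bin_Pr mulr_sumr; apply: ler_sum => W aW; rewrite mulrC.
by rewrite ler_wpM2l // Bin_mass_ge0.
Qed.

Lemma sum_setU_le (R : realType) (T : finType) (A B : {set T}) (f : T -> R) :
  (forall x, 0 <= f x) ->
  \sum_(x in A :|: B) f x <= \sum_(x in A) f x + \sum_(x in B) f x.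
Proof.
move=> f0; rewrite [in leRHS]big_mkcond [X in _ <= _ + X]big_mkcond.
rewrite -big_split big_mkcond; apply: ler_sum => x _ /=; rewrite inE.
by case: (x \in A); case: (x \in B); rewrite /= ?addr0 ?add0r // lerDl.
Qed.

(* The sets [T] with [T \in V (W :|: T)] cover the members of [F] without small
   fragment; Markov's inequality bounds their cost. *)
Lemma fragments_expensive (R : realType) (U : finType) (F : {set {set U}})
    (p Q c a : R) (s : nat) (V : {set U} -> {set {set U}}) :
  0 < p <= 1 -> 0 <= Q -> 0 < a ->
  expensive Q c F ->
  (forall Z, \sum_(T in V Z | T \subset Z) (Q / p) ^+ #|T| <= a / 4) ->
  (forall W S, S \in F ->
     (exists2 T : {set U}, T \subset S & T \in fragments F s W) \/
     (exists2 T : {set U}, T \subset S & T \in V (W :|: T))) ->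
  Bin_Pr p (fun W => ~~ `[< expensive Q (c - a) (fragments F s W) >]) <= 1 / 4.
Proof.
move=> /andP[p0 p1] Q0 a0 Fc Va FV.
have p01 : 0 <= p <= 1 by rewrite ltW.
pose G (W : {set U}) := [set T : {set U} | T \in V (W :|: T)].
apply: (@le_trans _ _ (Bin_Pr p (fun W => a <= cover_cost Q (G W)))).
  apply: sub_Bin_Pr => // W /asboolPn Wbad; rewrite leNgt; apply/negP => GWa.
  apply: Wbad => G' G'F.
  suff /Fc : covers (G' :|: G W) F.
    rewrite /cover_cost => cG; rewrite ltrBlDr (lt_le_trans cG) //.
    rewrite (le_trans (sum_setU_le _ _ _)) //; last by rewrite lerD2l ltW.
    by move=> T; rewrite exprn_ge0.
  apply/forallP => S; apply/implyP => SF; case: (FV W S SF) => -[T TS TF].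
    have /forallP/(_ T)/implyP/(_ TF)/existsP[T' /andP[T'G T'T]] := G'F.
    by apply/existsP; exists T'; rewrite inE T'G (subset_trans T'T).
  by apply/existsP; exists T; rewrite inE [T \in G W]inE TF orbT.
apply: Bin_Pr_markov => //.
  by move=> W; apply: sumr_ge0 => T _; rewrite exprn_ge0.
rewrite (eq_bigr (fun W => Bin_mass p W *
    \sum_(T : {set U} | T \in V (W :|: T)) Q ^+ #|T|)); last first.
  by move=> W _; congr (_ * _); apply: eq_bigl => T; rewrite inE.
rewrite expected_cover_cost // mul1r -[leRHS]mul1r.
rewrite -[X in _ <= X * _](Bin_mass_sum U p) mulr_suml.
by apply: ler_sum => Z _; rewrite ler_wpM2l ?Bin_mass_ge0 // Va.
Qed.

(* A failed round is wasted but harmless, so it suffices that each round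
   succeeds with probability at least [3 / 4]. *)
Lemma rounds (R : realType) (U : finType) (p : R)
    (L : nat -> {set {set U}} -> Prop) :
  0 <= p <= 1 ->
  (forall F, L 0 F -> set0 \in F) ->
  (forall k F, L k.+1 F ->
     Bin_Pr p (fun W => ~~ `[< exists2 F' : {set {set U}}, L k F' &
       forall T : {set U}, T \in F' -> contains_member F (W :|: T) >]) <=
     1 / 4) ->
  forall N k F, L k F ->
  Bin_Pr (1 - (1 - p) ^+ N) (predC (contains_member F)) <= 4 ^+ k / 2 ^+ N.
Proof.
move=> p01 L0 LS; have /andP[p0 p1] := p01.
have r01 N : 0 <= 1 - (1 - p) ^+ N <= 1.
  by rewrite subr_ge0 exprn_ile1 ?subr_ge0 ?gerBl //= exprn_ge0 ?subr_ge0.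
elim=> [|N IH] k F LF.
  rewrite expr0 divr1 (le_trans (Bin_Pr_le1 _ _)) ?exprn_ege1 ?ler1n //.
  by rewrite subrr lexx ler01.
case: k LF => [LF|k LF].
  rewrite /Bin_Pr big_pred0 ?divr_ge0 ?exprn_ge0 // => W /=; apply/negbTE.
  by rewrite negbK; apply/existsP; exists set0; rewrite L0 ?sub0set.
have -> : 1 - (1 - p) ^+ N.+1 =
    p + (1 - (1 - p) ^+ N) - p * (1 - (1 - p) ^+ N) by rewrite exprS; ring.
rewrite Bin_Pr_union.
pose bad W := ~~ `[< exists2 F' : {set {set U}}, L k F' &
  forall T : {set U}, T \in F' -> contains_member F (W :|: T) >].
(* A good round leads to level [k], a bad one stays at [k.+1]; the two contributions are at most
   [4 ^+ k / 2 ^+ N] each. *)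
apply: (@le_trans _ _ (\sum_W (Bin_mass p W * (4 ^+ k / 2 ^+ N) +
    (if bad W then Bin_mass p W else 0) * (4 ^+ k.+1 / 2 ^+ N)))); last first.
  rewrite big_split /= -!mulr_suml Bin_mass_sum -big_mkcond /=.
  apply: (@le_trans _ _ (1 * (4 ^+ k / 2 ^+ N) +
      1 / 4 * (4 ^+ k.+1 / 2 ^+ N))).
    by rewrite lerD2l ler_wpM2r ?LS // divr_ge0 ?exprn_ge0.
  rewrite !exprS le_eqVlt; apply/orP; left; apply/eqP; field.
  by rewrite expf_neq0.
apply: ler_sum => W _.
have [Wbad|/negPn/asboolP[F' LF' F'F]] := boolP (bad W).
  rewrite ler_wpDl //; first by rewrite mulr_ge0 ?Bin_mass_ge0 // divr_ge0 ?exprn_ge0.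
  rewrite ler_wpM2l ?Bin_mass_ge0 //; apply: le_trans (IH _ _ LF).
  apply: sub_Bin_Pr => // W' /=; apply: contra; apply: contains_memberS.
  exact: subsetUr.
rewrite mul0r addr0 ler_wpM2l ?Bin_mass_ge0 //.
apply: le_trans (IH _ _ LF'); apply: sub_Bin_Pr => // W' /=.
apply: contra => /existsP[T /andP[TF' TW']].
by apply: contains_memberS (F'F _ TF'); rewrite setUS.
Qed.

Lemma expensive_neq0 (R : realType) (U : finType) (Q c : R)
    (F : {set {set U}}) : 0 <= c -> expensive Q c F -> F != set0.
Proof.
move=> c0 Fc; apply/eqP => F0; have : covers set0 F.
  by apply/forallP => S; rewrite F0 inE.
by move=> /Fc; rewrite /cover_cost big_set0 ltNge c0.
Qed.

(** The choice depends on [Z] alone, so the covers built from it are functions of [W :|: T], as in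
    [fragments_expensive]. *)
Definition member_in (U : finType) (F : {set {set U}}) (Z : {set U}) :
  {set U} := odflt set0 [pick S in F | S \subset Z].

Lemma member_inP (U : finType) (F : {set {set U}}) (Z : {set U}) :
  contains_member F Z -> member_in F Z \in F /\ member_in F Z \subset Z.
Proof.
rewrite /member_in => /existsP[S SFZ]; case: pickP => [T /andP[] //|/(_ S)].
by rewrite SFZ.
Qed.

Lemma sum_powers_le (R : realType) (U : finType) (A : {set {set U}}) (x : R)
    (t n : nat) : 0 <= x <= 1 -> (forall T, T \in A -> t <= #|T|)%N ->
  (#|A| <= n)%N -> \sum_(T in A) x ^+ #|T| <= n%:R * x ^+ t.
Proof.
move=> /andP[x0 x1] At An.
apply: (@le_trans _ _ (\sum_(T in A) x ^+ t)).
  by apply: ler_sum => T TA; rewrite ler_wiXn2l // At.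
by rewrite sumr_const -[leLHS]mulr_natl ler_wpM2r ?exprn_ge0 // ler_nat.
Qed.

(** [V Z] consists of the large subsets of one chosen member inside [Z], at most [2 ^ l] sets. If
    [T = S' :\: W] has minimal size among the members [S'] inside [W :|: S], then every member
    inside [W :|: T] contains [T], in particular the chosen one. *)
Lemma halving_round (R : realType) (U : finType) (F : {set {set U}})
    (p Q c a : R) (l s : nat) :
  0 < Q -> 0 < p <= 1 -> Q <= p -> 0 < a -> expensive Q c F ->
  (forall S, S \in F -> #|S| <= l)%N ->
  (2 ^ l)%:R * (Q / p) ^+ s <= a / 4 ->
  Bin_Pr p (fun W => ~~ `[< expensive Q (c - a) (fragments F s W) >]) <= 1 / 4.
Proof.
move=> Q0 p01 Qp a0 Fc Fl cost; have /andP[p0 p1] := p01.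
pose V (Z : {set U}) := [set T : {set U} in powerset (member_in F Z) |
  (s <= #|T|)%N && contains_member F Z].
apply: (@fragments_expensive _ _ _ _ _ _ _ _ V) => //; first exact: ltW.
  move=> Z; apply: le_trans cost.
  rewrite (eq_bigl (mem [set T : {set U} in V Z | T \subset Z])); last first.
    by move=> T; rewrite !inE.
  apply: sum_powers_le.
  - by rewrite divr_ge0 ?(ltW Q0) ?(ltW p0)//= ler_pdivrMr ?mul1r.
  - by move=> T; rewrite !inE => /andP[/andP[_ /andP[]]].
  have [FZ|FZ] := boolP (contains_member F Z); last first.
    rewrite (_ : [set _ | _] = set0) ?cards0 //; apply/setP => T.
    by rewrite !inE (negbTE FZ) !andbF.
  have [mF _] := member_inP FZ.
  apply: leq_trans (leq_pexp2l _ (Fl _ mF)) => //.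
  rewrite -card_powerset; apply/subset_leq_card/subsetP => T.
  by rewrite !inE => /andP[/andP[]].
move=> W S SF.
pose P := [pred S' : {set U} | (S' \in F) && (S' \subset W :|: S)].
have PS : P S by rewrite /= SF subsetUr.
case: (arg_minnP (fun S' : {set U} => #|S' :\: W|) PS) => S' /andP[S'F S'WS] S'min.
pose T := S' :\: W.
have TS : T \subset S by rewrite subDset.
have S'WT : S' \subset W :|: T by rewrite -subDset.
have FWT : contains_member F (W :|: T) by apply/existsP; exists S'; rewrite S'F.
have [Ts|sT] := ltnP #|T| s; [left|right]; exists T => //; first by rewrite inE Ts.
rewrite !inE FWT sT !andbT; have [mF mWT] := member_inP FWT.
set S'' := member_in F _ in mF mWT *.
have S''T : S'' :\: W \subset T by rewrite subDset.
suff /eqP <- : S'' :\: W == T by exact: subsetDl.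
rewrite eqEcard S''T; apply: S'min; rewrite /= mF (subset_trans mWT) //.
by rewrite setUS.
Qed.

(** * The Sauer-Shelah lemma *)

(* Pajor's strengthening of the Sauer-Shelah lemma. *)
Lemma card_shattered (U : finType) (A : {set {set U}}) :
  (#|A| <= #|[set D : {set U} | shatters A D]|)%N.
Proof.
have [n] := ubnP #|A|; elim: n A => // n IH A An.
have shS (B C : {set {set U}}) D : B \subset C -> shatters B D -> shatters C D.
  move=> BC /eqP BD; rewrite /shatters eqEsubset; apply/andP; split.
    by apply/subsetP => _ /imsetP[S _ ->]; rewrite inE subsetIr.
  by rewrite -BD imsetS.
have [->|[S SA]] := set_0Vmem A; first by rewrite cards0.
have [/eqP ->|] := boolP (A == [set S]).
  rewrite cards1 card_gt0; apply/set0Pn; exists set0; rewrite inE /shatters.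
  by rewrite imset_set1 setI0 powerset0.
rewrite eqEsubset sub1set SA andbT => /subsetPn[S' S'A]; rewrite inE => SS'.
have [x xSS'] : exists x, (x \in S) != (x \in S').
  apply/existsP; apply: contraR SS' => /existsPn H; apply/eqP/setP => x.
  by have := H x; rewrite negbK eq_sym => /eqP.
pose A1 := [set T : {set U} in A | x \in T]; pose A0 := A :\: A1.
have A0E T : (T \in A0) = (T \in A) && (x \notin T).
  by rewrite !inE; case: (T \in A); rewrite ?andbT ?andbF.
have A1A : A1 \subset A by apply/subsetP => T; rewrite inE => /andP[].
have cA : #|A| = (#|A1| + #|A0|)%N.
  by rewrite -[LHS](cardsID A1) (setIidPr A1A).
have A1n : (0 < #|A1|)%N.
  apply/card_gt0P; have [xS|xS] := boolP (x \in S).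
    by exists S; rewrite inE SA.
  by exists S'; rewrite inE S'A; case: (x \in S') xSS' xS => //; case: (x \in S).
have A0n : (0 < #|A0|)%N.
  apply/card_gt0P; have [xS|xS] := boolP (x \in S).
    by exists S'; rewrite A0E S'A; case: (x \in S') xSS' => //; rewrite xS.
  by exists S; rewrite A0E SA.
rewrite ltnS cA in An.
have IH1 : (#|A1| <= #|[set D : {set U} | shatters A1 D]|)%N.
  by apply: IH; apply: leq_trans An; rewrite -addn1 leq_add2l.
have IH0 : (#|A0| <= #|[set D : {set U} | shatters A0 D]|)%N.
  by apply: IH; apply: leq_trans An; rewrite -add1n leq_add2r.
set Sh1 := [set D : {set U} | shatters A1 D] in IH1.
set Sh0 := [set D : {set U} | shatters A0 D] in IH0.
have x1 D : D \in Sh1 -> x \notin D.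
  rewrite inE => /eqP sD; apply/negP => xD.
  have : set0 \in powerset D by rewrite inE sub0set.
  rewrite -sD => /imsetP[T]; rewrite inE => /andP[_ xT] /setP/(_ x).
  by rewrite !inE xT xD.
have x0 D : D \in Sh0 -> x \notin D.
  rewrite inE => /eqP sD; apply/negP => xD.
  have : D \in powerset D by rewrite inE.
  rewrite -sD => /imsetP[T]; rewrite A0E => /andP[_ xT] /setP/(_ x).
  by rewrite !inE (negbTE xT) xD.
(* A set [D] shattered by both halves accounts for two sets shattered by [A]: [D] and [x |: D]. *)
have inj : {in Sh1 :&: Sh0 &, injective (fun D => x |: D)}.
  move=> D D' /setIP[/x1 xD _] /setIP[/x1 xD' _] E.
  by rewrite -(setU1K xD) -(setU1K xD') E.
rewrite cA (leq_trans (leq_add IH1 IH0)) // -cardsUI -(card_in_imset inj).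
rewrite -cardsUI (_ : (_ :|: _) :&: _ = set0) ?cards0 ?addn0.
  apply/subset_leq_card/subsetP => D; rewrite !inE => /orP[/orP[]|].
  - exact: shS.
  - by apply: shS; rewrite subsetDl.
  case/imsetP => E; rewrite !inE => /andP[/[dup] E1 /eqP sE1 /eqP sE0] ->.
  have xE : x \notin E by apply: x1; rewrite inE.
  rewrite /shatters eqEsubset; apply/andP; split.
    by apply/subsetP => _ /imsetP[T _ ->]; rewrite inE subsetIr.
  apply/subsetP => T; rewrite inE => TE.
  have TxE : T :\ x \in powerset E by rewrite inE subDset.
  have [xT|xT] := boolP (x \in T).
    move: TxE; rewrite -sE1 => /imsetP[B]; rewrite inE => /andP[BA xB] TB.
    apply/imsetP; exists B => //; apply/setP => y; move/setP/(_ y): TB.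
    by rewrite !inE; case: eqVneq => [->|_] //=; rewrite xT xB.
  move: TxE; rewrite -sE0 => /imsetP[B]; rewrite A0E => /andP[BA xB] TB.
  apply/imsetP; exists B => //; apply/setP => y; move/setP/(_ y): TB.
  by rewrite !inE; case: eqVneq => [->|_] //=; rewrite (negbTE xT) (negbTE xB).
apply/setP => D; rewrite !inE; apply/negbTE/negP => /andP[D01 /imsetP[E _ DE]].
have : x \in D by rewrite DE setU11.
by apply/negP; case/orP: D01 => D01; [apply: x1|apply: x0]; rewrite inE.
Qed.

Lemma bin_leq_exp (n m : nat) : ('C(n, m) <= n ^ m)%N.
Proof.
have H : (n ^_ m <= n ^ m)%N.
  by elim: m => // m IH; rewrite ffactnSr expnSr leq_mul // leq_subr.
by apply: leq_trans H; rewrite -bin_ffact leq_pmulr // fact_gt0.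
Qed.

Lemma card_small_subsets (U : finType) (H : {set U}) (d : nat) :
  (#|[set D : {set U} | (D \subset H) && (#|D| <= d)]| <= #|H|.+1 ^ d)%N.
Proof.
elim: d => [|d IH].
  rewrite expn0 -(cards1 (set0 : {set U})); apply/subset_leq_card/subsetP => D.
  by rewrite !inE leqn0 cards_eq0 => /andP[].
have sub : [set D : {set U} | (D \subset H) && (#|D| <= d.+1)%N] \subset
    [set D : {set U} | (D \subset H) && (#|D| <= d)%N] :|:
    [set D : {set U} | (D \subset H) && (#|D| == d.+1)].
  by apply/subsetP => D; rewrite !inE leq_eqVlt ltnS orbC => /andP[-> ->].
apply: leq_trans (subset_leq_card sub) _; apply: leq_trans (leq_card_setU _ _) _.
rewrite cards_draws expnS mulSn leq_add // (leq_trans (bin_leq_exp _ _)) //.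
by rewrite expnS leq_mul //; case: (d) => // e; rewrite leq_exp2r.
Qed.

(** A set shattered by the traces lies in [H] and is shattered by [F], so Pajor's bound leaves only
    subsets of [H] of size at most [VC F]. *)
Lemma card_traces (U : finType) (F : {set {set U}}) (H : {set U}) :
  (#|[set S :&: H | S in F]| <= #|H|.+1 ^ VC F)%N.
Proof.
apply: leq_trans (card_shattered _) _.
apply: leq_trans (card_small_subsets H (VC F)).
apply/subset_leq_card/subsetP => D; rewrite !inE => sD.
have DH : D \subset H.
  have : D \in powerset D by rewrite inE.
  rewrite -(eqP sD) => /imsetP[_ /imsetP[S _ ->] ->].
  by rewrite (subset_trans (subsetIl _ _)) // subsetIr.
rewrite DH /VC (@leq_bigmax_cond _ (shatters F)) //.
rewrite /shatters -(eqP sD) -imset_comp; apply/eqP/eq_imset => S /=.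
by rewrite -setIA (setIidPr DH).
Qed.

(** * Measures of minimal energy *)

Definition prob_on (R : realType) (U : finType) (F : {set {set U}})
    (Z : {set U}) (nu : {set U} -> R) : Prop :=
  [/\ forall S, 0 <= nu S,
      forall S, nu S != 0 -> (S \in F) && (S \subset Z)
    & \sum_S nu S = 1].

Definition load (R : realType) (U : finType) (nu : {set U} -> R) (x : U) : R :=
  \sum_(S : {set U} | x \in S) nu S.

Definition energy (R : realType) (U : finType) (nu : {set U} -> R) : R :=
  \sum_x load nu x ^+ 2.

Definition minimizes_energy (R : realType) (U : finType) (F : {set {set U}})
    (Z : {set U}) (nu : {set U} -> R) : Prop :=
  prob_on F Z nu /\
  forall nu', prob_on F Z nu' -> energy nu <= energy nu'.

Lemma prob_on_dirac (R : realType) (U : finType) (F : {set {set U}})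
    (Z S : {set U}) : S \in F -> S \subset Z ->
  prob_on F Z (fun T => (T == S)%:R : R).
Proof.
move=> SF SZ; split.
- by move=> T; exact: ler0n.
- by move=> T; case: (eqVneq T S) => [->|_]; rewrite ?eqxx // SF SZ.
- by rewrite (bigD1 S) //= eqxx big1 ?addr0 // => T /negbTE ->.
Qed.

Lemma load_dirac (R : realType) (U : finType) (S : {set U}) (x : U) :
  load (fun T => (T == S)%:R : R) x = (x \in S)%:R.
Proof.
rewrite /load; have [xS|xS] := boolP (x \in S).
  by rewrite (bigD1 S) //= eqxx big1 ?addr0 // => T /andP[_ /negbTE ->].
by rewrite big1 // => T xT; case: (eqVneq T S) xT xS => // -> ->.
Qed.

Lemma prob_on_mix (R : realType) (U : finType) (F : {set {set U}})
    (Z : {set U}) (a : R) (nu nu' : {set U} -> R) :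
  0 <= a <= 1 -> prob_on F Z nu -> prob_on F Z nu' ->
  prob_on F Z (fun S => (1 - a) * nu S + a * nu' S).
Proof.
move=> /andP[a0 a1] [n0 nF n1] [n0' nF' n1']; split.
- by move=> S; rewrite addr_ge0 // mulr_ge0 // subr_ge0.
- move=> S; have [->|/nF->//] := eqVneq (nu S) 0.
  have [->|/nF'->//] := eqVneq (nu' S) 0.
  by rewrite !mulr0 addr0 eqxx.
- by rewrite big_split /= -!mulr_sumr n1 n1' !mulr1 subrK.
Qed.

Lemma load_mix (R : realType) (U : finType) (a : R)
    (nu nu' : {set U} -> R) (x : U) :
  load (fun S => (1 - a) * nu S + a * nu' S) x =
  (1 - a) * load nu x + a * load nu' x.
Proof. by rewrite /load big_split /= -!mulr_sumr. Qed.

Lemma prob_onS (R : realType) (U : finType) (F : {set {set U}})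
    (Z Z' : {set U}) (nu : {set U} -> R) :
  Z \subset Z' -> prob_on F Z nu -> prob_on F Z' nu.
Proof.
move=> ZZ' [n0 nF n1]; split=> // S /nF/andP[-> SZ].
exact: subset_trans ZZ'.
Qed.

(** Compactness: the measures are row vectors indexed by all subsets, with inadmissible coordinates
    forced to [0], and the energy is continuous. *)
Lemma energy_min_exists (R : realType) (U : finType) (F : {set {set U}})
    (Z : {set U}) : contains_member F Z ->
  exists nu : {set U} -> R, minimizes_energy F Z nu.
Proof.
move=> /existsP[S0 /andP[S0F S0Z]].
pose n := #|{set U}|.
pose nu (v : 'rV[R]_n) (S : {set U}) : R := v ord0 (enum_rank S).
pose A (i : 'I_n) : set R :=
  if (enum_val i \in F) && (enum_val i \subset Z) then `[0, 1]%classic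
  else [set 0 : R]%classic.
pose B : set 'rV[R]_n := [set v | forall i, A i (v ord0 i)]%classic.
pose f (v : 'rV[R]_n) : R := \sum_S nu v S.
have nu_cont S : continuous (fun v : 'rV[R]_n => nu v S).
  exact: coord_continuous.
have sum_cont (I : finType) (P : pred I) (h : I -> 'rV[R]_n -> R) :
    (forall i, continuous (h i)) ->
    continuous (fun v => \sum_(i | P i) h i v).
  by move=> h_cont; apply: continuous_big => //; exact: add_continuous.
have f_cont : continuous f by apply: sum_cont => S; exact: nu_cont.
have Bcomp : compact (B `&` f @^-1` [set 1])%classic.
  apply: compact_closedI.
    apply: rV_compact => i; rewrite /A; case: ifP => _.
      exact: segment_compact.
    exact: compact_set1.
  by apply: preimage_closed => //; exact: closed_eq.
have probP v : (B `&` f @^-1` [set 1])%classic v <-> prob_on F Z (nu v).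
  split=> [[Bv fv]|[v0 vF v1]].
    split=> //.
      move=> S; have := Bv (enum_rank S); rewrite /A /nu.
      by case: ifP => _ /=; [rewrite in_itv /= => /andP[]|move=> ->].
    move=> S; have := Bv (enum_rank S); rewrite /A /nu enum_rankK.
    by case: ifP => // _ ->; rewrite eqxx.
  split=> // i; rewrite /A -[i]enum_valK enum_rankK -/(nu v _).
  case: ifP => [_|/negbT ni] /=.
    rewrite in_itv /= v0 -v1 (bigD1 (enum_val i)) //= lerDl.
    exact: sumr_ge0.
  by apply/eqP; apply: contraNT ni => /vF.
pose of_nu (mu : {set U} -> R) : 'rV[R]_n := \row_i mu (enum_val i).
have nuK mu : nu (of_nu mu) = mu.
  by apply/funext => S; rewrite /nu /of_nu mxE enum_rankK.
have load_cont x : continuous (fun v => load (nu v) x).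
  by apply: sum_cont => S; exact: nu_cont.
have en_cont : continuous (fun v => energy (nu v)).
  apply: sum_cont => x v; under eq_fun do rewrite expr2.
  exact: (continuousM (load_cont x v) (load_cont x v)).
have [|v vB vmin] := compact_EVT_min _ Bcomp (continuous_subspaceT en_cont).
  by exists (of_nu (fun T => (T == S0)%:R)); apply/probP; rewrite nuK;
    exact: prob_on_dirac.
exists (nu v); split; first exact/probP/set_mem.
move=> mu mup; rewrite -(nuK mu); apply/vmin/mem_set/probP.
by rewrite nuK.
Qed.

(* An arbitrary minimizer, or [0] if [Z] contains no member of [F]. *)
Definition equilibrium (R : realType) (U : finType) (F : {set {set U}})
    (Z : {set U}) : {set U} -> R :=
  xget (fun=> 0) [set nu | minimizes_energy F Z nu]%classic.

Lemma equilibriumP (R : realType) (U : finType) (F : {set {set U}})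
    (Z : {set U}) :
  contains_member F Z -> minimizes_energy F Z (equilibrium R F Z).
Proof.
move=> FZ; have [nu nuP] := energy_min_exists R FZ.
suff : [set nu | minimizes_energy F Z nu]%classic (equilibrium R F Z) by [].
by apply: xgetPex; exists nu.
Qed.

Lemma load_ge0 (R : realType) (U : finType) (F : {set {set U}})
    (Z : {set U}) (nu : {set U} -> R) (x : U) :
  prob_on F Z nu -> 0 <= load nu x.
Proof. by case=> nu0 _ _; apply: sumr_ge0 => S _. Qed.

Lemma load_le1 (R : realType) (U : finType) (F : {set {set U}})
    (Z : {set U}) (nu : {set U} -> R) (x : U) :
  prob_on F Z nu -> load nu x <= 1.
Proof.
case=> nu0 _ <-; rewrite [leRHS](bigID (fun S : {set U} => x \in S)) /= lerDl.
exact: sumr_ge0.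
Qed.

Lemma energy_ge0 (R : realType) (U : finType) (nu : {set U} -> R) :
  0 <= energy nu.
Proof. by apply: sumr_ge0 => x _; exact: sqr_ge0. Qed.

(* First order condition: moving mass towards the point mass at [S] does not
   decrease the energy. *)
Lemma energy_le_load (R : realType) (U : finType) (F : {set {set U}})
    (Z S : {set U}) (nu : {set U} -> R) :
  minimizes_energy F Z nu -> S \in F -> S \subset Z ->
  energy nu <= \sum_(x in S) load nu x.
Proof.
move=> [nuP nu_min] SF SZ; set e := energy nu; set s := \sum_(x in S) _.
have e0 : 0 <= e by exact: energy_ge0.
have s0 : 0 <= s by apply: sumr_ge0 => x _; exact: load_ge0 nuP.
have H (a : R) : 0 <= a <= 1 ->
    e <= (1 - a) ^+ 2 * e + 2 * a * (1 - a) * s + a ^+ 2 * #|S|%:R.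
  move=> a01.
  have := nu_min _ (prob_on_mix a01 nuP (prob_on_dirac R SF SZ)).
  congr (_ <= _); rewrite /energy.
  rewrite (eq_bigr (fun x => (1 - a) ^+ 2 * load nu x ^+ 2 +
     2 * a * (1 - a) * (load nu x * (x \in S)%:R) + a ^+ 2 * (x \in S)%:R)).
    rewrite !big_split /= -!mulr_sumr -/(energy nu) -/e; congr (_ + _ * _ + _ * _).
      rewrite /s [RHS]big_mkcond; apply: eq_bigr => x _.
      by case: (x \in S); rewrite ?mulr1 ?mulr0.
    by rewrite -sum1_card natr_sum [RHS]big_mkcond; apply: eq_bigr => x _;
      case: (x \in S).
  by move=> x _; rewrite load_mix load_dirac; case: (x \in S) => /=; ring.
rewrite leNgt; apply/negP => se.
have n0 : (0 : R) <= #|S|%:R by [].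
set n : R := #|S|%:R in n0 H.
(* [D] is at least [e - s], so that [a <= 1], and at least [e - 2 * s + n], so that [a] times this
   coefficient stays below the first order gain [2 * (e - s)]. *)
pose D := (e - s) + e + n.
have D0 : 0 < D by rewrite /D; lra.
pose a := (e - s) / D.
have aD : a * D = e - s by rewrite /a mulfVK // gt_eqF.
have a0 : 0 < a by rewrite /a divr_gt0 // subr_gt0.
have a1 : a <= 1 by rewrite /a ler_pdivrMr // mul1r /D; lra.
have := H a; rewrite (ltW a0) a1 => /(_ isT).
have -> : (1 - a) ^+ 2 * e + 2 * a * (1 - a) * s + a ^+ 2 * n =
  e - a * (2 * (e - s) - a * (e - 2 * s + n)) by ring.
rewrite lerBrDl gerDr leNgt mulr_gt0 // subr_gt0.
apply: (@le_lt_trans _ _ (a * D)); last by rewrite aD; lra.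
by rewrite ler_pM2l // /D; lra.
Qed.

(* Parallelogram identity. *)
Lemma load_dist_le (R : realType) (U : finType) (F : {set {set U}})
    (Z Z' : {set U}) (nu nu' : {set U} -> R) :
  minimizes_energy F Z nu -> prob_on F Z' nu' -> Z' \subset Z ->
  \sum_x (load nu x - load nu' x) ^+ 2 <= 2 * (energy nu' - energy nu).
Proof.
move=> [nuP nu_min] nuP' Z'Z.
have half01 : 0 <= (1 / 2 : R) <= 1.
  by rewrite divr_ge0 //= ler_pdivrMr ?mul1r ?ler1n.
pose mid (S : {set U}) : R := (1 - 1 / 2) * nu S + 1 / 2 * nu' S.
have nu_mid : energy nu <= energy mid.
  exact: nu_min _ (prob_on_mix half01 nuP (prob_onS Z'Z nuP')).
have -> : \sum_x (load nu x - load nu' x) ^+ 2 =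
    2 * energy nu + 2 * energy nu' - 4 * energy mid.
  rewrite /energy !mulr_sumr -big_split -sumrB /=.
  by apply: eq_bigr => x _; rewrite load_mix; field.
by lra.
Qed.

Lemma card_load_ge (R : realType) (U : finType) (nu : {set U} -> R) (t : R) :
  0 <= t -> #|[set x | t <= load nu x]|%:R * t ^+ 2 <= energy nu.
Proof.
move=> t0; rewrite -sum1_card natr_sum mulr_suml.
rewrite /energy [leRHS](bigID (mem [set x | t <= load nu x])) /= ler_wpDr //.
  by apply: sumr_ge0 => x _; exact: sqr_ge0.
apply: ler_sum => x; rewrite inE mul1r => tx.
by rewrite ler_pXn2r // nnegrE // (le_trans t0).
Qed.

(** Condition [nu] on avoiding [A]. This event has mass [M >= 1 - a] by the union bound, loads grow
    at most by the factor [1 / M], and [1 <= (1 + 4 * a) * (1 - a) ^+ 2] for [a <= 1 / 4]. *)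
Lemma energy_delete (R : realType) (U : finType) (F : {set {set U}})
    (Z A : {set U}) (nu : {set U} -> R) :
  prob_on F Z nu -> \sum_(x in A) load nu x <= 1 / 4 ->
  exists2 nu', prob_on F (Z :\: A) nu' &
    energy nu' <= (1 + 4 * \sum_(x in A) load nu x) * energy nu.
Proof.
move=> [nu0 nuF nu1] a4; set a := \sum_(x in A) _ in a4 *.
have a0 : 0 <= a.
  by apply: sumr_ge0 => x _; apply: sumr_ge0.
pose M := \sum_(S : {set U} | [disjoint S & A]) nu S.
have M0 : 0 <= M by apply: sumr_ge0.
have Ma : 1 - a <= M.
  rewrite lerBlDr -nu1 (bigID (fun S : {set U} => [disjoint S & A])) /= -/M.
  rewrite lerD2l /a /load (exchange_big_dep predT) //=.
  rewrite [leLHS]big_mkcond; apply: ler_sum => S _; case: ifP => [|_].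
    rewrite -setI_eq0 => /set0Pn[x /setIP[xS xA]].
    rewrite (bigD1 x) /=; last by rewrite xA.
    by rewrite lerDl; apply: sumr_ge0.
  by apply: sumr_ge0.
have Mp : 0 < M by lra.
exists (fun S : {set U} => if [disjoint S & A] then nu S / M else 0).
  split.
  - by move=> S; case: ifP => // _; rewrite divr_ge0.
  - move=> S; case: ifP => [SA|_]; last by rewrite eqxx.
    rewrite mulf_eq0 negb_or => /andP[/nuF/andP[-> SZ] _].
    by rewrite subsetD SZ SA.
  - by rewrite -big_mkcond -mulr_suml /= divff // gt_eqF.
apply: (@le_trans _ _ (energy nu / M ^+ 2)).
  rewrite /energy mulr_suml; apply: ler_sum => x _; rewrite -expr_div_n.
  rewrite ler_pXn2r // ?nnegrE.
  - rewrite /load mulr_suml; apply: ler_sum => S _; case: ifP => // _.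
    by rewrite divr_ge0.
  - by apply: sumr_ge0 => S _; case: ifP => // _; rewrite divr_ge0.
  - by rewrite divr_ge0 // sumr_ge0.
rewrite mulrC ler_wpM2r ?energy_ge0 // -[leLHS]mul1r ler_pdivrMr ?exprn_gt0 //.
have : (1 - a) ^+ 2 <= M ^+ 2 by rewrite ler_pXn2r ?nnegrE //; lra.
move=> MM; apply: (@le_trans _ _ ((1 + 4 * a) * (1 - a) ^+ 2)).
  have : 0 <= a * (2 - 7 * a + 4 * a ^+ 2).
    by rewrite mulr_ge0 //; nra.
  have -> : (1 + 4 * a) * (1 - a) ^+ 2 =
    1 + a * (2 - 7 * a + 4 * a ^+ 2) by ring.
  by lra.
by rewrite ler_wpM2l //; lra.
Qed.

(** * Heavy points *)

Definition heavy (R : realType) (U : finType) (F : {set {set U}})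
    (Z : {set U}) (i : nat) : {set U} :=
  [set x | (1 / 2 : R) ^+ i <= load (equilibrium R F Z) x].

Lemma heavy_sub (R : realType) (U : finType) (F : {set {set U}})
    (Z : {set U}) (i : nat) : contains_member F Z -> heavy R F Z i \subset Z.
Proof.
move=> /(equilibriumP R)[[nu0 nuF _] _]; apply/subsetP => x; rewrite inE => xi.
apply: contraTT xi => xZ; rewrite -ltNge (_ : load _ _ = 0) ?exprn_gt0 //.
apply: big1 => S xS; apply/eqP; apply: contraNT xZ => /nuF/andP[_ /subsetP].
exact.
Qed.

Lemma prob_on_contains (R : realType) (U : finType) (F : {set {set U}})
    (Z : {set U}) (nu : {set U} -> R) : prob_on F Z nu -> contains_member F Z.
Proof.
move=> [_ nuF nu1].
have /existsP[S /nuF SF] : [exists S, nu S != 0].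
  apply: contraT => /existsPn nu0; move: (oner_neq0 R).
  by rewrite -nu1 big1 ?eqxx // => S _; apply/eqP/negPn.
by apply/existsP; exists S.
Qed.

Lemma energy_equilibrium_delete (R : realType) (U : finType)
    (F : {set {set U}}) (Z A : {set U}) (a : R) :
  contains_member F Z ->
  \sum_(x in A) load (equilibrium R F Z) x <= a -> a <= 1 / 4 ->
  contains_member F (Z :\: A) /\
  energy (equilibrium R F (Z :\: A)) <=
    (1 + 4 * a) * energy (equilibrium R F Z).
Proof.
move=> FZ Aa a4; have [nuP _] := equilibriumP R FZ.
have [nu' nu'P nu'e] := energy_delete nuP (le_trans Aa a4).
have FZA := prob_on_contains nu'P; split=> //.
have [_ /(_ _ nu'P) le'] := equilibriumP R FZA.
apply: le_trans le' (le_trans nu'e _).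
by rewrite ler_wpM2r ?energy_ge0 // lerD2l ler_wpM2l.
Qed.

(** Dyadic layers: points with load between [2 ^- (i + 1)] and [2 ^- i] contribute at most
    [2 ^- i * D * (i + 1)]; summing over [i >= r] gives the bound. The induction stops once
    [r >= #|U|], where counting all points is enough. *)
Lemma light_mass (R : realType) (U : finType) (m : U -> R) (S : {set U})
    (D j : nat) : (0 < D)%N -> (forall x, 0 <= m x) ->
  (forall i, j < i ->
    #|[set x in S | ((1 / 2 : R) ^+ i <= m x)%R]| <= D * i)%N ->
  forall r, (j < r)%N ->
  \sum_(x in S | m x < (1 / 2) ^+ r) m x <= (1 / 2) ^+ r * (D * (2 * r + 4))%:R.
Proof.
move=> D0 m0 mD.
have e0 i : 0 <= (1 / 2 : R) ^+ i by rewrite exprn_ge0.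
suff H k r : (j < r)%N -> (#|U| <= r + k)%N ->
  \sum_(x in S | m x < (1 / 2) ^+ r) m x <= (1 / 2) ^+ r * (D * (2 * r + 4))%:R.
  by move=> r jr; apply: (H #|U|) => //; rewrite leq_addl.
elim: k r => [|k IH] r jr Uk.
  apply: (@le_trans _ _ (\sum_(x in S | m x < (1 / 2) ^+ r) (1 / 2) ^+ r)).
    by apply: ler_sum => x /andP[_ /ltW].
  rewrite (eq_bigl (mem [set x in S | m x < (1 / 2) ^+ r])); last first.
    by move=> x; rewrite !inE.
  rewrite sumr_const -[leLHS]mulr_natr ler_wpM2l // ler_nat.
  rewrite addn0 in Uk; apply: leq_trans (max_card _) _; apply: leq_trans Uk _.
  by nia.
rewrite (bigID (fun x => (1 / 2) ^+ r.+1 <= m x)) /=.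
have -> : (1 / 2) ^+ r * (D * (2 * r + 4))%:R =
    (1 / 2 : R) ^+ r * (D * r.+1)%:R + (1 / 2) ^+ r.+1 * (D * (2 * r.+1 + 4))%:R.
  by rewrite exprS !natrM !natrD !natrM -natr1; field.
apply: lerD.
  apply: (@le_trans _ _
    (\sum_(x in [set x in S | (1 / 2) ^+ r.+1 <= m x]) (1 / 2) ^+ r)).
    rewrite [leLHS]big_mkcond [leRHS]big_mkcond; apply: ler_sum => x _ /=.
    rewrite !inE; case: (x \in S) => //=.
    by case: ltP => /= [/ltW xr|_]; case: ifP.
  by rewrite sumr_const -[leLHS]mulr_natr ler_wpM2l // ler_nat mD // ltnW.
have jr1 : (j < r.+1)%N by rewrite ltnW.
have Ur1 : (#|U| <= r.+1 + k)%N by rewrite addSnnS.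
apply: le_trans (IH r.+1 jr1 Ur1).
rewrite [leLHS]big_mkcond [leRHS]big_mkcond; apply: ler_sum => x _ /=.
case: (x \in S) => //=; rewrite -ltNge.
by case: ifP => [/andP[_ ->]//|_]; case: ifP.
Qed.

Lemma mul26_leq_exp4 (j : nat) : (4 <= j)%N -> (26 * j + 4 <= 4 ^ j)%N.
Proof.
elim: j => // j IH; rewrite leq_eqVlt => /predU1P[<-|j4]; first by [].
by rewrite expnS; have := IH j4; move: (4 ^ j)%N => x; lia.
Qed.

(* Let [nu] be the equilibrium on [W :|: S]. By the first order condition [S]
   carries at least the energy of [nu]. Take for [j] the finest scale at which
   [S] has too many heavy points; the finer points of [S] then have negligible
   load, so deleting them barely changes the energy. Minimizing energy plus a
   small multiple of the cardinality over the remaining subsets yields [T] all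
   of whose points are heavy for the equilibrium on [W :|: T]. As both
   energies are nearly equal, the two equilibria are close in [l^2], so the
   points of [S] which were heavy before remain so. *)
Lemma heavy_core (R : realType) (U : finType) (F : {set {set U}})
    (W S : {set U}) (D j0 : nat) :
  (0 < D)%N -> (D <= 2 ^ j0)%N -> (4 <= j0)%N -> S \in F ->
  exists j T, let H := heavy R F (W :|: T) (15 * j) in
  [/\ (j0 <= j <= j0 + #|U|)%N, T \subset S, contains_member F (W :|: T),
      T \subset H & (#|H| <= 2 ^ (34 * j))%N /\
      ((j == j0) || (D * j < #|S :&: H|)%N)].
Proof.
move=> D0 Dj0 j04 SF; pose Z0 := W :|: S.
have FZ0 : contains_member F Z0.
  by apply/existsP; exists S; rewrite SF subsetUr.
have [nu0P nu0min] := equilibriumP R FZ0.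
set nu0 := equilibrium R F Z0 in nu0P nu0min.
pose m0 := load nu0.
have m0_ge0 x : 0 <= m0 x by exact: load_ge0 nu0P.
have m0_le1 x : m0 x <= 1 by exact: load_le1 nu0P.
pose N i := #|[set x in S | ((1 / 2 : R) ^+ i <= m0 x)%R]|.
(* The range is capped so that a largest [j] exists. Nothing is lost: beyond [j0 + #|U|],
   [N i <= #|U| <= D * i] trivially. *)
pose P j := ((j0 <= j <= j0 + #|U|) && ((j == j0) || (D * j < N j)))%N.
have exP : exists j, P j by exists j0; rewrite /P leqnn leq_addr eqxx.
have ubP j : P j -> (j <= j0 + #|U|)%N by case/andP => /andP[].
case: (ex_maxnP exP ubP) => j /andP[/andP[j0j jU] Pj] jmax.
have j4 : (4 <= j)%N by exact: leq_trans j0j.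
have ND i : (j < i)%N -> (N i <= D * i)%N.
  move=> ji; have [iU|Ui] := leqP i (j0 + #|U|).
    rewrite leqNgt; apply/negP => Di; have := jmax i.
    rewrite /P iU Di orbT (leq_trans j0j (ltnW ji)) => /(_ isT).
    by rewrite leqNgt ji.
  rewrite (leq_trans (max_card _)) // (leq_trans _ (leq_pmull i D0)) //.
  by rewrite (leq_trans (leq_addl j0 _)) // ltnW.
have j13 : (j < 13 * j)%N by clear -j4; lia.
have j26 : (13 * j <= 26 * j + 4)%N by clear; lia.
(* All estimates below are in powers of [t = 2 ^- j]; counts are bounded by powers of [B], which
   [t * B = 1] trades for powers of [t]. *)
pose t : R := (1 / 2) ^+ j; pose B : R := 2 ^+ j.
have t0 : 0 < t by rewrite /t exprn_gt0.
have B0 : 0 < B by rewrite /B exprn_gt0.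
have tB : t * B = 1 by rewrite /t /B -exprMn mulfVK ?expr1n.
have tk k : (1 / 2 : R) ^+ (k * j) = t ^+ k by rewrite mulnC exprM.
have t16 : t <= 1 / 16.
  apply: (@le_trans _ _ ((1 / 2) ^+ 4)); last by lra.
  by rewrite /t ler_wiXn2l //; lra.
have tBk k l : t ^+ (k + l) * B ^+ k = t ^+ l.
  by rewrite exprD mulrAC -exprMn tB expr1n mul1r.
(* [26 * j + 4] is the [2 * r + 4] of [light_mass] at [r = 13 * j]. *)
have DB3 : (D * (26 * j + 4))%:R <= B ^+ 3.
  rewrite /B -exprM -natrX ler_nat [(j * 3)%N]mulnC expnM.
  rewrite (_ : (2 ^ 3)%N = (2 * 4)%N) // expnMn leq_mul ?mul26_leq_exp4 //.
  by rewrite (leq_trans Dj0) // leq_exp2l.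
have light r : (j < r)%N -> \sum_(x in S | m0 x < (1 / 2) ^+ r) m0 x <=
    (1 / 2) ^+ r * (D * (2 * r + 4))%:R.
  by apply: light_mass => // i /ND.
pose g0 := energy nu0.
(* The energy is at most the load of [S]: its points below scale [j.+1] are controlled by [light],
   and at most [D * j.+1] others have load at most [1] each. *)
have g0B : g0 <= B ^+ 3.
  apply: (le_trans _ DB3).
  apply: (le_trans (energy_le_load (equilibriumP R FZ0) SF _)).
    exact: subsetUr.
  rewrite -/nu0 -/m0 (bigID (fun x => m0 x < (1 / 2) ^+ j.+1)) /=.
  apply: (@le_trans _ _ ((D * (2 * j.+1 + 4))%:R + (D * j.+1)%:R)); last first.
    by rewrite -natrD ler_nat; nia.
  apply: lerD.
    apply: le_trans (light _ (ltnSn j)) _; rewrite ler_piMl //.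
    by rewrite exprn_ile1 //; lra.
  apply: (@le_trans _ _ (\sum_(x in [set x in S | (1 / 2) ^+ j.+1 <= m0 x]) 1)).
    rewrite [leLHS]big_mkcond [leRHS]big_mkcond; apply: ler_sum => x _ /=.
    by rewrite !inE -leNgt; case: ifP.
  by rewrite sumr_const ler_nat ND.
(* The cutoff [t ^+ 13] makes the deleted load at most [t ^+ 13 * B ^+ 3 = t ^+ 10], so the energy
   rises by at most [4 * t ^+ 7]. *)
pose T1 := [set x in S :\: W | (1 / 2) ^+ (13 * j) <= m0 x].
pose A := (S :\: W) :\: T1.
have ZA : Z0 :\: A = W :|: T1.
  apply/setP => x; rewrite !inE.
  by case: (x \in W); case: (x \in S); case: (_ <= _).
have At : \sum_(x in A) m0 x <= t ^+ 10.
  apply: (@le_trans _ _ (\sum_(x in S | m0 x < (1 / 2) ^+ (13 * j)) m0 x)).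
    rewrite [leLHS]big_mkcond [leRHS]big_mkcond; apply: ler_sum => x _ /=.
    rewrite !inE ltNge.
    by case: (x \in S); case: (x \in W); case: (_ <= m0 x);
      rewrite /= ?lexx ?m0_ge0.
  apply: le_trans (light _ j13) _.
  rewrite tk -(tBk 3 10) ler_wpM2l ?exprn_ge0 ?(ltW t0) //.
  by rewrite (le_trans _ DB3) // ler_nat mulnA.
have t10 : t ^+ 10 <= 1 / 4.
  rewrite (le_trans _ (_ : t <= _)) //; last by lra.
  by rewrite exprS ler_piMr ?(ltW t0) // exprn_ile1 ?(ltW t0) //; lra.
have [FT1 eT1] := energy_equilibrium_delete FZ0 At t10.
rewrite ZA -/g0 in FT1 eT1.
have cT1 : #|T1|%:R <= B ^+ 3.
  apply: le_trans DB3; rewrite ler_nat.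
  apply: (@leq_trans (N (13 * j)%N)).
    apply/subset_leq_card/subsetP => x; rewrite !inE.
    by move=> /andP[/andP[_ ->] ->].
  by rewrite (leq_trans (ND _ j13)) // leq_mul.
pose en T := energy (equilibrium R F (W :|: T)).
(* The penalty [t ^+ 9] is small enough to total at most [t ^+ 6] on [T1], yet exceeds the energy
   increase [4 * t ^+ 11] caused by deleting a point of load below [t ^+ 15]. *)
pose G (T : {set U}) : R := en T + t ^+ 9 * #|T|%:R.
pose PT := [pred T : {set U} | (T \subset T1) && contains_member F (W :|: T)].
have PT1 : PT T1 by rewrite /= subxx.
case: (arg_minP G PT1) => T /andP[TT1 FT] Tmin.
have t2 k l : (k <= l)%N -> t ^+ l <= t ^+ k.
  by move=> kl; rewrite ler_wiXn2l ?(ltW t0) //; lra.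
have tS k : 16 * t ^+ k.+1 <= t ^+ k.
  by rewrite exprS mulrA ler_piMl ?exprn_ge0 ?(ltW t0) //; lra.
have GT : G T <= g0 + t ^+ 5.
  apply: le_trans (Tmin _ PT1) _; rewrite /G.
  have h1 : t ^+ 9 * #|T1|%:R <= t ^+ 6.
    by rewrite -(tBk 3 6) ler_wpM2l ?exprn_ge0 ?(ltW t0).
  have h2 : 4 * t ^+ 10 * g0 <= 4 * t ^+ 7.
    by rewrite -mulrA ler_wpM2l // -(tBk 3 7) ler_wpM2l ?exprn_ge0 ?(ltW t0).
  have h3 := tS 5; have h4 := tS 6; have h5 : 0 <= t ^+ 7.
    by rewrite exprn_ge0 ?(ltW t0).
  by move: eT1; rewrite -/(en T1) mulrDl mul1r; lra.
have enT : en T <= g0 + t ^+ 5.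
  by apply: le_trans GT; rewrite lerDl mulr_ge0 ?exprn_ge0 ?(ltW t0).
have enB : en T <= B ^+ 4.
  apply: le_trans enT _; apply: (@le_trans _ _ (B ^+ 3 + B ^+ 3)).
    apply: lerD => //; apply: (@le_trans _ _ 1).
      by rewrite exprn_ile1 ?(ltW t0) //; lra.
    by rewrite exprn_ege1 // /B exprn_ege1 // ler1n.
  rewrite [B ^+ 4]exprSr -mulr2n -[leLHS]mulr_natr ler_wpM2l ?exprn_ge0 ?(ltW B0) //.
  by rewrite /B -[leLHS]expr1 ler_eXn2l ?ltr1n // (leq_trans _ j4).
have [nuTP _] := equilibriumP R FT.
set nuT := equilibrium R F (W :|: T) in nuTP.
exists j, T => H.
have HE x : (x \in H) = (t ^+ 15 <= load nuT x) by rewrite inE tk.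
have TS : T \subset S.
  apply: subset_trans TT1 _; apply/subsetP => x.
  by rewrite !inE => /andP[/andP[]].
have TH : T \subset H.
  apply/subsetP => x xT; rewrite HE leNgt; apply/negP => xlight.
  have xW : x \notin W.
    by have := subsetP TT1 _ xT; rewrite !inE => /andP[/andP[]].
  have ZTx : (W :|: T) :\: [set x] = W :|: (T :\ x).
    apply/setP => y; rewrite !inE; case: eqVneq => [->|_] //=.
    by rewrite (negbTE xW).
  have t15 : t ^+ 15 <= 1 / 4 by apply: le_trans t10; exact: t2.
  have xload : \sum_(y in [set x]) load nuT y <= t ^+ 15.
    by rewrite big_set1 ltW.
  have [FTx] := energy_equilibrium_delete FT xload t15.
  rewrite ZTx in FTx * => eTx.
  have PTx : PT (T :\ x) by rewrite /= FTx (subset_trans (subsetDl _ _)).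
  have := Tmin _ PTx; rewrite leNgt => /negP; apply.
  rewrite /G (cardsD1 x T) xT add1n -natr1 mulrDr mulr1.
  have h2 : 4 * t ^+ 15 * en T <= 4 * t ^+ 11.
    by rewrite -mulrA ler_wpM2l // -(tBk 4 11) ler_wpM2l ?exprn_ge0 ?(ltW t0).
  have h3 := tS 10; have h4 : t ^+ 10 <= t ^+ 9 by exact: t2.
  have h5 : 0 < t ^+ 11 by rewrite exprn_gt0.
  by move: eTx; rewrite -/(en _) -/(en T) mulrDl mul1r; lra.
split=> //; first by rewrite j0j.
split.
  (* Chebyshev's inequality at level [t ^+ 15]; with [t * B = 1] it gives [#|H| <= B ^+ 34]. *)
  have cH : #|H|%:R * t ^+ 30 <= B ^+ 4.
    have -> : H = [set x | t ^+ 15 <= load nuT x].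
      by apply/setP => x; rewrite HE inE.
    rewrite [t ^+ 30](exprM t 15 2); apply: le_trans enB.
    exact: card_load_ge (exprn_ge0 15 (ltW t0)).
  rewrite -(ler_nat R) natrX [(34 * j)%N]mulnC exprM -/B.
  rewrite -(ler_pM2r (exprn_gt0 30 t0)) (le_trans cH) //.
  have := tBk 30 0; rewrite addn0 expr0 => tB30.
  by rewrite (exprD B 4 30) -mulrA [_ * t ^+ 30]mulrC tB30 mulr1.
case/orP: Pj => [->//|Nj]; apply/orP; right; apply: leq_trans Nj _.
apply/subset_leq_card/subsetP => x; rewrite inE => /andP[xS tx].
(* Otherwise [x] alone contributes at least [t ^+ 2 / 4] to a squared distance that is at most
   [2 * t ^+ 5]. *)
rewrite inE xS HE leNgt; apply/negP => xlight.
have := load_dist_le (equilibriumP R FZ0) nuTP (setUS W TS).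
rewrite -/nu0 -/g0 -/(en T) => dist.
have h1 : (t / 2) ^+ 2 <= (load nu0 x - load nuT x) ^+ 2.
  have h : t / 2 <= load nu0 x - load nuT x.
    have := tS 1%N; have : t ^+ 15 <= t ^+ 2 by exact: t2.
    by rewrite -/(m0 x) expr1; move: tx; rewrite -/t; lra.
  by rewrite ler_pXn2r // nnegrE ?divr_ge0 ?(ltW t0) // (le_trans _ h) //
    divr_ge0 ?(ltW t0).
have h2 : (load nu0 x - load nuT x) ^+ 2 <=
    \sum_y (load nu0 y - load nuT y) ^+ 2.
  by rewrite [leRHS](bigD1 x) //= lerDl sumr_ge0 // => y _; exact: sqr_ge0.
have h3 := tS 2%N; have h4 : t ^+ 5 <= t ^+ 3 by exact: t2.
have h5 : 0 < t ^+ 2 by rewrite exprn_gt0.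
have h6 : (t / 2) ^+ 2 = t ^+ 2 / 4 by field.
by move: h1 h2 dist; rewrite h6; lra.
Qed.

Lemma sum_bigcup_le (R : realType) (I T : finType) (P : pred I)
    (A : I -> {set T}) (f : T -> R) :
  (forall x, 0 <= f x) ->
  \sum_(x in \bigcup_(i | P i) A i) f x <= \sum_(i | P i) \sum_(x in A i) f x.
Proof.
move=> f0; apply: (big_ind2 (fun (B : {set T}) y => \sum_(x in B) f x <= y)).
- by rewrite big_set0.
- move=> B y B' y' By B'y'; apply: le_trans (lerD By B'y').
  exact: sum_setU_le.
- by [].
Qed.

Lemma sum_half_powers (R : realType) (n : nat) :
  \sum_(i < n) (1 / 2 : R) ^+ i = 2 - 2 * (1 / 2) ^+ n.
Proof.
elim: n => [|n IH]; first by rewrite big_ord0 expr0; ring.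
by rewrite big_ord_recr /= IH exprS; field.
Qed.

(** The count is at most [2 ^ (35 * j * d)] and the weight is [2 ^- (40 * j * d)]; the surplus
    [5 * j * d] is at least [j + 16] because [j >= 4]. *)
Lemma trace_cost (R : realType) (d j : nat) : (0 < d)%N -> (4 <= j)%N ->
  (((2 ^ (34 * j)).+1 ^ d)%N)%:R * (1 / 2 ^+ 10) ^+ (4 * d * j) <=
    (1 / 2 : R) ^+ (j + 16).
Proof.
move=> d0 j4.
have h0 : (0 : R) <= 1 / 2 by lra.
have -> : (1 / 2 ^+ 10 : R) = (1 / 2) ^+ 10 by rewrite expr_div_n expr1n.
rewrite -exprM.
apply: (@le_trans _ _ (2 ^+ (35 * j * d) * (1 / 2) ^+ (10 * (4 * d * j)))).
  rewrite ler_wpM2r ?exprn_ge0 // -natrX ler_nat [leqRHS]expnM leq_exp2r //.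
  have -> : (2 ^ (35 * j) = 2 ^ j * 2 ^ (34 * j))%N.
    by rewrite -expnD; congr (2 ^ _)%N; lia.
  apply: (@leq_trans (2 * 2 ^ (34 * j))).
    by rewrite mul2n -addnn -addn1 leq_add2l expn_gt0.
  rewrite leq_mul2r; apply/orP; right.
  by rewrite -[X in (X <= _)%N]expn1 leq_exp2l // (leq_trans _ j4).
rewrite (_ : 10 * (4 * d * j) = 35 * j * d + 5 * j * d)%N; last by lia.
rewrite exprD mulrA -exprMn (_ : 2 * (1 / 2) = 1 :> R); last by lra.
rewrite expr1n [leLHS]mul1r ler_wiXn2l //; first by lra.
by nia.
Qed.

Lemma vc_round (R : realType) (U : finType) (F : {set {set U}})
    (Q c : R) (d j0 : nat) :
  0 < Q -> 2 ^+ 10 * Q <= 1 -> (0 < d)%N -> (VC F <= d)%N ->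
  (4 <= j0)%N -> (4 * d <= 2 ^ j0)%N -> expensive Q c F ->
  Bin_Pr (2 ^+ 10 * Q) (fun W =>
    ~~ `[< expensive Q (c - 1 / 4) (fragments F (4 * d * j0) W) >]) <= 1 / 4.
Proof.
move=> Q0 Q1 d0 Fd j04 dj0 Fc; set p := 2 ^+ 10 * Q.
have p0 : 0 < p by rewrite mulr_gt0 ?exprn_gt0.
have QpE : Q / p = 1 / 2 ^+ 10.
  by rewrite /p; field; rewrite gt_eqF ?andbT ?expf_neq0.
have x01 : 0 <= (1 / 2 ^+ 10 : R) <= 1.
  by rewrite divr_ge0 ?exprn_ge0 //= ler_pdivrMr ?exprn_gt0 // mul1r exprn_ege1 ?ler1n.
(* The large traces on the heavy set of [Z]. The bound on [#|H|] is built in, so that Sauer-Shelah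
   limits their number for every [Z]. *)
pose V j (Z : {set U}) := let H := heavy R F Z (15 * j) in
  [set T in [set S :&: H | S in F] |
    ((4 * d * j <= #|T|) && (#|H| <= 2 ^ (34 * j)))%N].
pose VV (Z : {set U}) := \bigcup_(j < (j0 + #|U|).+1 | (j0 <= j)%N) V j Z.
apply: (@fragments_expensive _ _ _ _ _ _ _ _ VV) => //.
- by rewrite p0.
- exact: ltW.
- move=> Z; rewrite QpE.
  have f0 (T : {set U}) : 0 <= (1 / 2 ^+ 10 : R) ^+ #|T|.
    by rewrite exprn_ge0 //; case/andP: x01.
  apply: (@le_trans _ _ (\sum_(T in VV Z) (1 / 2 ^+ 10) ^+ #|T|)).
    rewrite [leLHS]big_mkcondr; apply: ler_sum => T _.
    by case: ifP => // _; exact: f0.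
  apply: le_trans (sum_bigcup_le _ _ f0) _.
  (* Scale [j] costs at most [2 ^- (j + 16)], so all scales together cost at most [2 ^- 15], below
     the allowed [1 / 16]. *)
  apply: (@le_trans _ _
      (\sum_(j < (j0 + #|U|).+1) (1 / 2) ^+ j * (1 / 2) ^+ 16)).
    rewrite big_mkcond; apply: ler_sum => j _.
    case: ifP => [j0j|_]; last by rewrite mulr_ge0 ?exprn_ge0.
    rewrite -exprD; apply: le_trans (trace_cost R d0 (leq_trans j04 j0j)).
    apply: sum_powers_le => //.
      by move=> T; rewrite inE => /andP[_ /andP[]].
    set H := heavy R F Z (15 * j).
    have [Hj|Hj] := leqP #|H| (2 ^ (34 * j)); last first.
      rewrite (_ : V _ _ = set0) ?cards0 //; apply/setP => T.
      by rewrite !inE -/H [(#|H| <= _)%N]leqNgt Hj !andbF.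
    apply: (@leq_trans #|[set S :&: H | S in F]|).
      by apply/subset_leq_card/subsetP => T; rewrite inE => /andP[].
    apply: leq_trans (card_traces F H) _.
    apply: (@leq_trans ((2 ^ (34 * j)).+1 ^ VC F)); last by rewrite leq_pexp2l.
    by case: (VC F) => // n; rewrite leq_exp2r.
  rewrite -mulr_suml sum_half_powers.
  have : 0 <= (1 / 2 : R) ^+ (j0 + #|U|).+1 by rewrite exprn_ge0.
  by move: (_ ^+ _.+1) => y y0; rewrite -[16%N]/(8 * 2)%N; lra.
move=> W S SF.
have D0 : (0 < 4 * d)%N by rewrite muln_gt0.
have [j [T [/andP[j0j jU] TS FT TH [Hj Nj]]]] := heavy_core R W D0 dj0 j04 SF.
set H := heavy R F (W :|: T) (15 * j) in TH Hj Nj.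
have [small|big] := ltnP #|S :&: H| (4 * d * j); [left|right].
  exists T => //; rewrite inE FT andbT.
  case/orP: Nj => [/eqP <-|/ltn_trans/(_ small)]; last by rewrite ltnn.
  by apply: leq_ltn_trans small; rewrite subset_leq_card // subsetI TS.
exists (S :&: H); first exact: subsetIl.
(* The trace contains [T] and lies in [W :|: T], so exchanging [T] for it changes neither the union
   nor its heavy set. *)
have -> : W :|: S :&: H = W :|: T.
  apply/eqP; rewrite eqEsubset !subUset !subsetUl /=; apply/andP; split.
    by rewrite (subset_trans (subsetIr _ _)) // heavy_sub.
  by rewrite (subset_trans _ (subsetUr _ _)) // subsetI TS.
apply/bigcupP; exists (inord j); rewrite inordK ?ltnS // inE big Hj !andbT.
by apply/imsetP; exists S.
Qed.

(** * The iteration *)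

(* The cost bounds increase to [1 / 4] with [k]; their increments pay for the
   sets discarded in the rounds. *)
Definition bounded_stage (R : realType) (U : finType) (Q : R) (k : nat)
    (F : {set {set U}}) : Prop :=
  (forall S : {set U}, S \in F -> #|S| < 2 ^ k)%N /\
  expensive Q (1 / 4 - (1 / 2) ^+ k.+2) F.

Lemma bounded_stage0 (R : realType) (U : finType) (Q : R)
    (F : {set {set U}}) : bounded_stage Q 0 F -> set0 \in F.
Proof.
move=> [F1 Fc]; have c0 : 0 <= 1 / 4 - (1 / 2 : R) ^+ 2 by lra.
have /set0Pn[S SF] := expensive_neq0 c0 Fc.
by have := F1 _ SF; rewrite expn0 ltnS leqn0 cards_eq0 => /eqP <-.
Qed.

(** A halving round with [l = 2 ^ k.+1], [s = 2 ^ k] and [a = 2 ^- (k + 3)]: its cost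
    [2 ^- (8 * 2 ^ k)] is at most [a / 4 = 2 ^- (k + 5)]. *)
Lemma bounded_stageS (R : realType) (U : finType) (Q : R) (k : nat)
    (F : {set {set U}}) :
  0 < Q -> 2 ^+ 10 * Q <= 1 -> bounded_stage Q k.+1 F ->
  Bin_Pr (2 ^+ 10 * Q) (fun W =>
    ~~ `[< bounded_stage Q k (fragments F (2 ^ k) W) >]) <= 1 / 4.
Proof.
move=> Q0 Q1 [Fs Fc]; set p := 2 ^+ 10 * Q.
have p0 : 0 < p by rewrite mulr_gt0 ?exprn_gt0.
have p01 : 0 <= p <= 1 by rewrite ltW.
have e0 : 0 < (1 / 2 : R) ^+ k.+3 by rewrite exprn_gt0.
apply: (@le_trans _ _ (Bin_Pr p (fun W => ~~ `[< expensive Q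
    (1 / 4 - (1 / 2) ^+ k.+3 - (1 / 2) ^+ k.+3) (fragments F (2 ^ k) W) >]))).
  apply: sub_Bin_Pr => // W; apply: contra => /asboolP exW; apply/asboolP.
  split; first by move=> T; rewrite inE => /andP[].
  have ee : (1 / 2 : R) ^+ k.+3 + (1 / 2) ^+ k.+3 = (1 / 2) ^+ k.+2.
    by rewrite [in LHS]exprS; field.
  by move=> G /exW; rewrite -addrA -opprD ee.
apply: (halving_round (l := 2 ^ k.+1)) => //.
- by rewrite p0.
- by rewrite /p ler_peMl ?(ltW Q0) // exprn_ege1 // ler1n.
- by move=> S /Fs/ltnW.
have -> : Q / p = (1 / 2) ^+ 10.
  rewrite expr_div_n expr1n /p; field.
  by rewrite gt_eqF ?andbT ?expf_neq0.
rewrite natrX expnS -exprM.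
rewrite (_ : 10 * 2 ^ k = 2 * 2 ^ k + 8 * 2 ^ k)%N; last by lia.
rewrite exprD mulrA -exprMn (_ : 2 * (1 / 2) = 1 :> R); last by lra.
rewrite expr1n [leLHS]mul1r.
have -> : (1 / 2 : R) ^+ k.+3 / 4 = (1 / 2) ^+ k.+3.+2.
  by rewrite [in RHS]exprS [in RHS]exprS; field.
rewrite ler_wiXn2l //; first by lra.
by have := ltn_expl k (isT : 1 < 2)%N; lia.
Qed.

Lemma union_rounds (R : realType) (U : finType) (F : {set {set U}})
    (Q : R) (d j0 N : nat) :
  0 < Q -> 2 ^+ 10 * Q <= 1 -> (0 < d)%N -> (VC F <= d)%N ->
  (4 <= j0)%N -> (4 * d <= 2 ^ j0)%N -> expensive Q (1 / 2) F ->
  Bin_Pr (1 - (1 - 2 ^+ 10 * Q) ^+ N) (predC (contains_member F)) <=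
    4 ^+ (2 * j0).+1 / 2 ^+ N.
Proof.
move=> Q0 Q1 d0 Fd j04 dj0 Fc; set p := 2 ^+ 10 * Q.
have p01 : 0 <= p <= 1 by rewrite Q1 mulr_ge0 ?exprn_ge0 // ltW.
pose K := (2 * j0)%N.
(* Level [K.+1] carries the VC bound. The preliminary round gives it up for sizes below
   [4 * d * j0 <= 2 ^ K], from where halving counts down. *)
pose L k (H : {set {set U}}) := if k == K.+1
  then (VC H <= d)%N /\ expensive Q (1 / 2) H
  else (k <= K)%N /\ bounded_stage Q k H.
have LF : L K.+1 F by rewrite /L eqxx.
apply: (rounds (L := L)) LF => // [H [_ /bounded_stage0 //]|k H].
have fragF (s : nat) (W T : {set U}) :
    T \in fragments H s W -> contains_member H (W :|: T).
  by rewrite inE => /andP[].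
rewrite /L; case: eqVneq => [[->]|kK].
  move=> [Hd Hc]; apply: le_trans (vc_round Q0 Q1 d0 Hd j04 dj0 Hc).
  apply: sub_Bin_Pr => // W; apply: contra => /asboolP exW; apply/asboolP.
  exists (fragments H (4 * d * j0) W); last by move=> T; exact: fragF.
  rewrite ltn_eqF // leqnn; split=> //; split.
    move=> T; rewrite inE => /andP[/leq_trans-> //].
    by rewrite /K mul2n -addnn expnD leq_mul // ltnW // ltn_expl.
  move=> G /exW; apply: le_lt_trans.
  have : 0 <= (1 / 2 : R) ^+ K.+2 by rewrite exprn_ge0.
  by move: (_ ^+ _) => x; lra.
move=> [kK' Hk]; apply: le_trans (bounded_stageS Q0 Q1 Hk).
apply: sub_Bin_Pr => // W; apply: contra => /asboolP exW; apply/asboolP.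
exists (fragments H (2 ^ k) W); last by move=> T; exact: fragF.
by rewrite ltn_eqF ?(ltnW kK') // ltnS ltnW.
Qed.

(** * Number of rounds and the final constant *)

Lemma bernoulli_inequality (R : realType) (p : R) (N : nat) :
  0 <= p <= 1 -> 1 - (1 - p) ^+ N <= N%:R * p.
Proof.
move=> /andP[p0 p1]; elim: N => [|N IH]; first by rewrite expr0 subrr mul0r.
have : 0 <= p * (1 - (1 - p) ^+ N).
  by rewrite mulr_ge0 // subr_ge0 exprn_ile1 ?subr_ge0 ?gerBl.
by rewrite exprS -natr1; lra.
Qed.

(** The singletons form a cheap cover at [1 / (2 * (#|U| + 1))]. Positivity puts [2 * q] strictly
    above [q], where no cover is cheap. *)
Lemma expectation_threshold_gt0 (R : realType) (U : finType)
    (F : {set {set U}}) : set0 \notin F -> F != set0 ->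
  0 < expectation_threshold R F.
Proof.
move=> F0 Fn0; have [_ ubq] := expectation_thresholdP R F0 Fn0.
pose x : R := (2 * #|U|.+1%:R)^-1.
have x0 : 0 < x by rewrite invr_gt0 mulr_gt0.
apply: (lt_le_trans x0 (ubq _ _)); split.
  by rewrite (ltW x0) invf_le1 ?mulr_gt0 // -natrM ler1n.
exists [set [set y] | y : U]; split.
  apply/forallP => S; apply/implyP => SF.
  have /set0Pn[y yS] : S != set0 by apply: contraNneq F0 => <-.
  by apply/existsP; exists [set y]; rewrite sub1set yS andbT imset_f.
rewrite (eq_bigr (fun=> x)); last by move=> _ /imsetP[y _ ->]; rewrite cards1.
rewrite sumr_const card_imset; last exact: set1_inj.
rewrite -[leLHS]mulr_natl /x invfM mulrCA div1r -[leRHS]mulr1.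
by rewrite ler_pM2l ?invr_gt0 // ler_pdivrMr // mul1r ler_nat.
Qed.

Lemma expensive_double (R : realType) (U : finType) (F : {set {set U}}) :
  set0 \notin F -> F != set0 -> 2 * expectation_threshold R F <= 1 ->
  expensive (2 * expectation_threshold R F) (1 / 2) F.
Proof.
move=> F0 Fn0 q1 G GF; have q0 := expectation_threshold_gt0 R F0 Fn0.
have [_ ubq] := expectation_thresholdP R F0 Fn0.
rewrite ltNge; apply/negP => cG.
have : 2 * expectation_threshold R F <= expectation_threshold R F.
  apply: ubq; split; last by exists G.
  by rewrite q1 mulr_ge0 // ltW.
by lra.
Qed.

Lemma ln2_ge (R : realType) : 1 / 2 <= ln (2 : R).
Proof.
have h : -1 < - (1 / 2) :> R by lra.
have := le_ln1Dx h; rewrite (_ : 1 + - (1 / 2) = 2^-1 :> R); last by field.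
by rewrite lnV ?posrE //; lra.
Qed.

Lemma Bin_Pr_contains_ge (R : realType) (U : finType) (F : {set {set U}})
    (d : nat) (eps : R) :
  set0 \notin F -> F != set0 -> (0 < d)%N -> (VC F <= d)%N ->
  0 < eps -> eps <= 1 / 2 ->
  1 - eps <= Bin_Pr (Num.min 1 (2 ^+ 11 * 31 * expectation_threshold R F *
    ln (d.+1%:R / eps))) (contains_member F).
Proof.
move=> F0 Fn0 d0 Fd e0 e1; set q := expectation_threshold R F.
have q0 : 0 < q by exact: expectation_threshold_gt0.
pose a : R := ln d.+1%:R; pose b : R := ln eps^-1.
have l2 := ln2_ge R.
have ei : 2 <= eps^-1 by rewrite -[leLHS]invrK lef_pV2 ?posrE //; lra.
have a2 : ln 2 <= a by rewrite ler_ln ?posrE // ler_nat ltnS.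
have b2 : ln 2 <= b by rewrite ler_ln ?posrE ?invr_gt0.
have -> : ln (d.+1%:R / eps) = a + b by rewrite lnM ?posrE ?invr_gt0.
set x := _ * (a + b).
have [x1|x1] := leP 1 x; first by rewrite Bin_Pr1 // gerBl ltW.
pose tl := trunc_log 2 d; pose j0 := (tl + 5)%N.
(* The first [2 * (2 * j0).+1] rounds cancel [4 ^+ (2 * j0).+1]; the other [n > 2 * b] leave
   [2 ^- n <= eps], as [ln 2 >= 1 / 2]. *)
pose n := (Num.truncn (2 * b)).+1; pose N := (2 * (2 * j0).+1 + n)%N.
have tla : tl%:R <= 2 * a.
  have : tl%:R * ln 2 <= a.
    rewrite mulr_natl -lnXn // ler_ln ?posrE ?exprn_gt0 // -natrX ler_nat.
    exact: leq_trans (trunc_logP _ d0) _.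
  by have := ler_wpM2l (ler0n R tl) l2; lra.
have nb : n%:R <= 2 * b + 1.
  by rewrite /n -natr1 lerD2r truncn_le //; lra.
have bn : 2 * b < n%:R by rewrite /n truncnS_gt.
have NE : N%:R = 4 * tl%:R + 22 + n%:R :> R.
  have -> : N = (4 * tl + 22 + n)%N.
    by rewrite /N /j0; clearbody n tl; clear; lia.
  by rewrite (natrD _ (4 * tl + 22)) (natrD _ (4 * tl)) natrM.
(* [N <= 8 * a + 2 * b + 23 <= 31 * (a + b)] because [a + b >= 1]. The factor [2 ^+ 11] is the round
   density [2 ^+ 10] times the doubling of [q]. *)
have Nx : N%:R * (2 ^+ 10 * (2 * q)) <= x.
  rewrite /x (_ : 2 ^+ 11 * 31 * q * (a + b) =
    (31 * (a + b)) * (2 ^+ 10 * (2 * q))); last by rewrite (exprSr 2 10); ring.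
  rewrite ler_wpM2r ?mulr_ge0 ?exprn_ge0 ?(ltW q0) //.
  by rewrite NE; lra.
have Q0 : 0 < 2 * q by rewrite mulr_gt0.
have p0 : 0 < 2 ^+ 10 * (2 * q) by rewrite mulr_gt0 ?exprn_gt0.
have p1 : 2 ^+ 10 * (2 * q) <= 1.
  apply: le_trans (ltW x1); apply: le_trans Nx; rewrite ler_peMl ?(ltW p0) //.
  by rewrite ler1n /N addnS.
have Q1 : 2 * q <= 1.
  by apply: le_trans p1; rewrite ler_peMl ?(ltW Q0) // exprn_ege1 // ler1n.
have j04 : (4 <= j0)%N by rewrite /j0 (leq_trans _ (leq_addl tl 5)).
have dj0 : (4 * d <= 2 ^ j0)%N.
  have := trunc_log_ltn d (isT : 1 < 2)%N; rewrite -/tl /j0 expnD expnS.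
  by move: (2 ^ tl)%N => y; clear; lia.
have := union_rounds N Q0 p1 d0 Fd j04 dj0 (expensive_double F0 Fn0 Q1).
set r := 1 - _ => fail_r.
have p01 : 0 <= 2 ^+ 10 * (2 * q) <= 1 by rewrite p1 ltW.
have r0 : 0 <= r.
  by rewrite subr_ge0 exprn_ile1 ?subr_ge0 // gerBl ltW.
have rx : r <= x by apply: le_trans Nx; exact: bernoulli_inequality.
apply: le_trans (Bin_Pr_le F r0 rx (ltW x1)).
rewrite -(Bin_PrC r (contains_member F)) lerBlDr lerD2l (le_trans fail_r) //.
have -> : 4 ^+ (2 * j0).+1 / 2 ^+ N = (2 ^+ n)^-1 :> R.
  rewrite /N exprD exprM (_ : 2 ^+ 2 = 4 :> R); last by ring.
  by rewrite invfM mulrA divff ?mul1r // expf_neq0.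
rewrite -[leRHS]invrK lef_pV2 ?posrE ?invr_gt0 ?exprn_gt0 //.
rewrite -ler_ln ?posrE ?invr_gt0 ?exprn_gt0 // lnXn // -/b -[leRHS]mulr_natl.
rewrite (le_trans _ (ler_wpM2l (ler0n R n) l2)) // mulrA mulr1.
by rewrite ler_pdivlMr // mulrC ltW.
Qed.

Theorem theorem1p1 (R : realType) :
  exists C : R, 0 < C /\
    forall (U : finType) (F : {set {set U}}) (d : nat),
      finset.set0 \notin F -> F != finset.set0 ->
      (1 <= d)%N -> (VC F <= d)%N ->
      (forall eps : R, 0 < eps -> eps <= 1 / 2 ->
         let p := Num.min 1
           (C * expectation_threshold R F * ln (d.+1%:R / eps)) in
         1 - eps <= Bin_Pr p (contains_member F)) /\
      threshold R F <= C * expectation_threshold R F * ln d.+1%:R.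
Proof.
pose C0 : R := 2 ^+ 11 * 31.
have C00 : 0 < C0 by rewrite mulr_gt0 ?exprn_gt0.
(* The factor [2] absorbs the extra [ln 2] at [eps = 1 / 2], as [ln 2 <= ln d.+1%:R]. *)
exists (2 * C0); split; first by rewrite mulr_gt0.
move=> U F d F0 Fn0 d0 Fd.
have q0 := expectation_threshold_gt0 R F0 Fn0.
set q := expectation_threshold R F in q0 *.
have ln_ge (eps : R) : 0 < eps -> eps <= 1 / 2 -> 0 <= ln (d.+1%:R / eps).
  move=> e0 e1; apply: ln_ge0; rewrite ler_pdivlMr // mul1r.
  by rewrite (@le_trans _ _ 1) ?ler1n //; lra.
split=> [eps e0 e1 /=|].
  apply: le_trans (Bin_Pr_contains_ge F0 Fn0 d0 Fd e0 e1) _.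
  have y0 : 0 <= C0 * q * ln (d.+1%:R / eps).
    by rewrite mulr_ge0 ?ln_ge // mulr_ge0 ?(ltW C00) ?(ltW q0).
  have yy : C0 * q * ln (d.+1%:R / eps) <= 2 * C0 * q * ln (d.+1%:R / eps).
    by rewrite -!(mulrA 2) ler_peMl // ler1n.
  apply: Bin_Pr_le; last by rewrite ge_min lexx.
    by rewrite le_min ler01; exact: y0.
  by rewrite le_min !ge_min lexx; apply/orP; right; exact: yy.
pose p : R := Num.min 1 (C0 * q * ln (d.+1%:R / (1 / 2))).
have h : (1 / 2 : R) <= 1 / 2 by [].
have h0 : (0 : R) < 1 / 2 by lra.
have y0 : 0 <= C0 * q * ln (d.+1%:R / (1 / 2)).
  by rewrite mulr_ge0 ?ln_ge // mulr_ge0 ?(ltW C00) ?(ltW q0).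
have Pp : 1 / 2 <= Bin_Pr p (contains_member F).
  have := Bin_Pr_contains_ge F0 Fn0 d0 Fd h0 h; rewrite -/C0 -/q -/p.
  by apply: le_trans; lra.
have p01 : 0 <= p <= 1 by rewrite le_min ler01 y0 ge_min lexx.
have [/andP[t0 t1] Pt] := thresholdP R F0 Fn0.
apply: (@le_trans _ _ p).
  (* Were [p] below the threshold, monotonicity would force probability exactly [1 / 2] at [p],
     against uniqueness. *)
  rewrite leNgt; apply/negP => pt; have /andP[p0 p1] := p01.
  have Pp' : Bin_Pr p (contains_member F) = 1 / 2.
    by apply/eqP; rewrite eq_le Pp andbT -Pt Bin_Pr_le // ltW.
  by have pE := threshold_unique F0 Fn0 p01 Pp'; rewrite -pE ltxx in pt.
rewrite ge_min; apply/orP; right.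
have -> : 2 * C0 * q * ln d.+1%:R = C0 * q * (ln d.+1%:R + ln d.+1%:R) by ring.
rewrite ler_pM2l ?mulr_gt0 // div1r invrK lnM ?posrE // lerD2l.
by rewrite ler_ln ?posrE // ler_nat ltnS.
Qed.
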